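(* Consider the $N$-player game with costs $f_i$, player dynamics $\dot x_i=u_i+g_i(\mathbf x)+d_i(t)$, communication graph $\mathcal G$, and the closed-loop system given by the control law $u_i=-\frac{\partial f_i}{\partial x_i}(\mathbf y_i)-\hat z_i$ together with the consensus/observer dynamics for $y_{ij},\hat x_i,\hat z_i$ with positive gains $\theta$, $k_s=\mathrm{diag}\{k_i^s\}$, $c=\mathrm{diag}\{c_i\}$, $\beta=\mathrm{diag}\{\beta_i\}$ (all described in the context). Suppose that: (1) for each $i\in\mathcal N$, $f_i$ is twice continuously differentiable on $\mathbb R^N$; (2) there is a constant $m>0$ such that $(\mathbf x-\mathbf z)^T(\Upsilon(\mathbf x)-\Upsilon(\mathbf z))\ge m\|\mathbf x-\mathbf z\|^2$ for all $\mathbf x,\mathbf z\in\mathbb R^N$, where $\Upsilon(\mathbf x)=\left[\frac{\partial f_1(\mathbf x)}{\partial x_1},\dots,\frac{\partial f_N(\mathbf x)}{\partial x_N}\right]^T$; (3) the communication graph $\mathcal G$ is undirected and connected; (4) the functions $g_i$, $i\in\mathcal N$, are sufficiently smooth, and $\frac{\partial g_i(\mathbf x)}{\partial x_j}$ and $\frac{\partial^2 g_i(\mathbf x)}{\partial x_j\partial x_k}$, $i,j,k\in\mathcal N$, are bounded given that $\mathbf x$ is bounded; the disturbances $d_i$, $i\in\mathcal N$, are sufficiently smooth, and $\dot d_i(t),\ddot d_i(t)$ are bounded for $i\in\mathcal N$, $t\ge t_0$. Then for any positive constant $v_1$ there exists $\theta^*(v_1)>0$ such that for each $\theta\in(\theta^*,\infty)$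 there exists a positive constant $k_s^r(v_1,\theta)$ such that for each choice of $k_i^s\in(k_s^r,\infty)$, $i\in\mathcal N$, there exists a positive constant $c^r(v_1,\theta,k_s)$ such that for each choice of $c_i\in(c^r,\infty)$, $i\in\mathcal N$, there exists a positive constant $\beta^r(v_1,\theta,c,k_s)$ such that for each choice of $\beta_i\in(\beta^r,\infty)$, $i\in\mathcal N$, $$\|\mathcal E_f(t)\|\to 0\quad\text{as } t\to\infty,$$ given that $\|\mathcal E_f(t_0)\|\le v_1$.
   Context: Game and dynamics. There are $N\ge 2$ players, $\mathcal N=\{1,\dots,N\}$. Player $i$ has action $x_i\in\mathbb R$, control input $u_i\in\mathbb R$, cost $f_i(\mathbf x)$ with $\mathbf x=[x_1,\dots,x_N]^T$, and dynamics $\dot x_i=u_i+g_i(\mathbf x)+d_i(t)$, $t\ge t_0$, where $g_i:\mathbb R^N\to\mathbb R$ is an unmodeled term, $d_i:[t_0,\infty)\to\mathbb R$ is an external disturbance and $t_0$ is the initial time. A Nash equilibrium is an action profile $\mathbf x^*=(x_i^*,\mathbf x_{-i}^* )$ such that for every $i\in\mathcal N$, $f_i(x_i^*,\mathbf x_{-i}^* )\le f_i(x_i,\mathbf x_{-i}^* )$ for all $x_i\in\mathbb R$, where $\mathbf x_{-i}$ collects the actions of all players other than $i$. Under hypotheses (1)-(2) the Nash equilibrium $\mathbf x^*$ exists and is unique. Communication graph. $\mathcal G$ is a weighted graph with node set $\mathcal N$ and adjacency matrix $\mathcal A=[a_{ij}]$: $a_{ij}>0$ if $(j,i)$ is an edge,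 $a_{ij}=0$ otherwise, and $a_{ii}=0$. It is undirected if $a_{ij}=a_{ji}$ for all $i,j$; an undirected graph is connected if there is a path between any two distinct nodes. Seeking strategy. The control law is $$u_i=-\frac{\partial f_i}{\partial x_i}(\mathbf y_i)-\hat z_i,\qquad \frac{\partial f_i}{\partial x_i}(\mathbf y_i)=\frac{\partial f_i(\mathbf x)}{\partial x_i}\Big|_{\mathbf x=\mathbf y_i},\quad \mathbf y_i=[y_{i1},\dots,y_{iN}]^T,$$ where, for $i,j\in\mathcal N$, $$\dot y_{ij}=-\theta_{ij}\Big(\sum_{k=1}^N a_{ik}(y_{ij}-y_{kj})+a_{ij}(y_{ij}-x_j)\Big),$$ $$\dot{\hat x}_i=u_i+\hat z_i+(k_i^s+c_i)(x_i-\hat x_i),\qquad \dot{\hat z}_i=k_i^sc_i(x_i-\hat x_i)+\beta_i\,\mathrm{sgn}(x_i-\hat x_i),$$ with $\theta_{ij}=\theta\bar\theta_{ij}$, where $\bar\theta_{ij}$ are fixed positive constants, $\theta,k_i^s,c_i,\beta_i$ are positive control gains, and $\mathrm{sgn}$ is the standard signum function. Error variables. With $z_i=g_i(\mathbf x)+d_i(t)$, set $\zeta_{i1}=x_i-\hat x_i$, $\zeta_{i2}=z_i-\hat z_i$, $\xi_i=x_i-x_i^*$, $\eta_{ij}=y_{ij}-x_j$. Let $\zeta_1,\zeta_2,\xi\in\mathbb R^N$ and $\eta\in\mathbb R^{N^2}$ be the corresponding stacked column vectors. Define the filtered signal $\gamma=\dot\zeta_1+c\,\zeta_1$ (equivalently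 $\gamma=\zeta_2-k_s\zeta_1$), and $\mathcal E_f=[\zeta_1^T,\zeta_2^T,\xi^T,\eta^T,\gamma^T]^T$. $\|\cdot\|$ is the Euclidean norm. *)

(* Defs.v *)
From HB Require Import structures.
From mathcomp Require Export all_boot all_order all_algebra.
From mathcomp Require Export all_classical all_reals all_analysis.

Set Implicit Arguments.
Unset Strict Implicit.
Unset Printing Implicit Defensive.

Import Order.TTheory GRing.Theory Num.Theory.
Import numFieldNormedType.Exports.

Local Open Scope classical_set_scope.
Local Open Scope ring_scope.

Section Calculus.
Context {R : realType} {N : nat}.
Implicit Types (h : 'rV[R]_N -> R) (i j : 'I_N).

(* The library norm on matrices is the sup norm, hence this definition. *)
Definition enorm (n : nat) (v : 'rV[R]_n) : R :=
  Num.sqrt (\sum_(i < n) v 0 i ^+ 2).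

Definition partial j h (x : 'rV[R]_N) : R := 'D_('e_j) h x.

Definition C1 h : Prop :=
  forall j, (forall x, derivable h x 'e_j) /\ continuous (partial j h).

(* Differentiability with continuous first partials makes h itself continuous,
   so iterating C1 gives the usual class. *)
Definition C2 h : Prop := C1 h /\ forall j, C1 (partial j h).

Definition bounded_on_bounded h : Prop :=
  forall r : R, exists B : R, forall x, enorm x <= r -> `|h x| <= B.

(* Derivative of a function on [t0, oo[: one-sided at t0, two-sided after. *)
Definition has_deriv_from (t0 : R) (p : R -> R) (t l : R) : Prop :=
  (p s - p t) / (s - t) @[s --> within [set s | t0 <= s] t^'] --> l.

End Calculus.

Section Game.
Context {R : realType} {N : nat}.
Implicit Types (f g : 'I_N -> 'rV[R]_N -> R) (x : 'rV[R]_N) (i : 'I_N).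

Definition deviate x i (r : R) : 'rV[R]_N :=
  \row_j (if j == i then r else x 0 j).

Definition is_nash f x : Prop :=
  forall i (r : R), f i x <= f i (deviate x i r).

Definition pseudo_gradient f x : 'rV[R]_N := \row_i partial i (f i) x.

Definition strongly_monotone (F : 'rV[R]_N -> 'rV[R]_N) : Prop :=
  exists m : R, 0 < m /\ forall x z,
    m * enorm (x - z) ^+ 2 <= ((x - z) *m (F x - F z)^T) 0 0.

Definition weighted_graph (a : 'M[R]_N) : Prop :=
  (forall i j, 0 <= a i j) /\ (forall i, a i i = 0).

Definition undirected (a : 'M[R]_N) : Prop := forall i j, a i j = a j i.

Definition connected_graph (a : 'M[R]_N) : Prop :=
  forall i j, connect (fun k l : 'I_N => 0 < a k l) i j.

(* "Sufficiently smooth" is read as C^2, the least regularity for which the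
   derivatives that are assumed bounded exist and are continuous. *)
Definition smooth_unmodeled g : Prop :=
  forall i, C2 (g i) /\
    (forall j, bounded_on_bounded (partial j (g i))) /\
    (forall j k, bounded_on_bounded (partial j (partial k (g i)))).

Definition smooth_disturbance (t0 : R) (d : 'I_N -> R -> R) : Prop :=
  forall i, exists d' d'' : R -> R,
    [/\ forall t, t0 <= t -> has_deriv_from t0 (d i) t (d' t),
        forall t, t0 <= t -> has_deriv_from t0 d' t (d'' t),
        {within `[t0, +oo[, continuous d''} &
        exists B : R, forall t, t0 <= t -> `|d' t| <= B /\ `|d'' t| <= B].

End Game.

Section ClosedLoop.
Context {R : realType} {N : nat}.
Variables (t0 : R) (f g : 'I_N -> 'rV[R]_N -> R) (d : 'I_N -> R -> R).
Variables (a : 'M[R]_N) (th : 'I_N -> 'I_N -> R) (ks c b : 'I_N -> R).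
Variables (x : R -> 'rV[R]_N) (y : R -> 'M[R]_N) (xh zh : R -> 'rV[R]_N).

Definition control (t : R) (i : 'I_N) : R :=
  - partial i (f i) (row i (y t)) - zh t 0 i.

Definition uncertainty (t : R) (i : 'I_N) : R := g i (x t) + d i t.

(* Filippov regularization of the signum function: sgn off 0, [-1, 1] at 0. *)
Definition Sgn (r : R) : set R :=
  [set v | -1 <= v <= 1 /\ (r != 0 -> v = Num.sg r)].

(* Filippov solutions on [t0, T[, with T finite or +oo.  The discontinuous
   term enters only the equation of zh.  Hence x, y and xh solve theirs at every
   time, while zh, which is merely locally absolutely continuous, is given by
   the integral of a measurable selection s.  As Sgn 0 contains sgn 0 = 0,
   solutions for the pointwise signum (classical or Caratheodory) are included;
   the set value at 0 is needed for solutions to exist from every initial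
   state. *)
Definition closed_loop_solution (T : \bar R) : Prop :=
  [/\ forall t i, t0 <= t -> (t%:E < T)%E ->
        has_deriv_from t0 (fun s => x s 0 i) t
          (control t i + g i (x t) + d i t),
      forall t i j, t0 <= t -> (t%:E < T)%E ->
        has_deriv_from t0 (fun s => y s i j) t
          (- th i j * (\sum_(k < N) a i k * (y t i j - y t k j)
                       + a i j * (y t i j - x t 0 j))),
      forall t i, t0 <= t -> (t%:E < T)%E ->
        has_deriv_from t0 (fun s => xh s 0 i) t
          (control t i + zh t 0 i + (ks i + c i) * (x t 0 i - xh t 0 i)) &
      exists s : 'I_N -> R -> R,
        [/\ forall i, measurable_fun [set t | t0 <= t /\ (t%:E < T)%E] (s i),
            forall t i, t0 <= t -> (t%:E < T)%E ->
              Sgn (x t 0 i - xh t 0 i) (s i t) &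
            forall t i, t0 <= t -> (t%:E < T)%E ->
              zh t 0 i = zh t0 0 i
                + \int[lebesgue_measure]_(r in `[t0, t])
                    (ks i * c i * (x r 0 i - xh r 0 i) + b i * s i r)]].

Definition zeta1 (t : R) : 'rV[R]_N := x t - xh t.

Definition zeta2 (t : R) : 'rV[R]_N := \row_i (uncertainty t i - zh t 0 i).

Definition xi (xs : 'rV[R]_N) (t : R) : 'rV[R]_N := x t - xs.

Definition eta (t : R) : 'M[R]_N := \matrix_(i, j) (y t i j - x t 0 j).

(* Along solutions, zeta1' = zeta2 - (ks + c) zeta1, so this is
   zeta1' + c zeta1. *)
Definition gamma (t : R) : 'rV[R]_N :=
  \row_i (zeta2 t 0 i - ks i * zeta1 t 0 i).

Definition error (xs : 'rV[R]_N) (t : R) : 'rV[R]_(N + (N + (N + (N * N + N)))) :=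
  row_mx (zeta1 t) (row_mx (zeta2 t)
    (row_mx (xi xs t) (row_mx (mxvec (eta t)) (gamma t)))).

End ClosedLoop.

(* Main.v *)
Require Import Defs.
From mathcomp Require Import ring lra.
Import Order.TTheory GRing.Theory Num.Theory.
Import numFieldNormedType.Exports.
Local Open Scope classical_set_scope.
Local Open Scope ring_scope.

(** Write the system around the observer state [xh], which does not see the
    discontinuous term directly. The slow errors [xh - xs] and [y_ij - xh_j] have
    a quadratic Lyapunov function, by strong monotonicity and by coercivity of the
    pinned Laplacians; for large [theta] it decays up to an input of order
    [(ks + c) |x - xh|]. The fast variables are the observation errors [x - xh]
    and [om = d + g xh - zh - ks (x - xh)], that is [gamma] without
    [g x - g xh]. This correction is bounded by [x - xh] alone, so that the energy
    [om_i^2 / 2 + beta_i |x_i - xh_i| - (x_i - xh_i) h_i], where [h_i] is the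
    Lipschitz part of the derivative of [om_i], can be divided by [beta_i]
    and then decays at the rate [c_i |x_i - xh_i|], uniformly in [beta]. Its
    initial value is bounded uniformly in [beta] as well, although the [beta_i]
    are unbounded and may be of different orders of magnitude. A linear
    combination of both functions is an exponentially decaying Lyapunov function
    on a region whose size depends only on the initial error. Since [zh] is
    merely Lipschitz, the decay is expressed by upper right Dini derivatives,
    which can be bounded at every time, including at the zeros of [x_i - xh_i]. *)

Set Implicit Arguments.
Unset Strict Implicit.
Unset Printing Implicit Defensive.

(** * One-sided derivatives and Dini inequalities *)

(** The obstacle is a circle: the derivative bounds come from a box, the gains are chosen from these
    bounds, and the trajectory must stay in the box for every such choice of gains. So the radius
    [r] may depend only on [v1] and fixed data, and neither the level set that traps the trajectory
    nor the initial Lyapunov value may depend on the gains. This explains why the observation error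
    enters to the first power. Inside the region it feeds the slow part by at most a multiple of
    [r * c i * |obs_err i|], and the fast part decays by a multiple of [c i * |obs_err i|]; a weight
    proportional to [r] and free of all gains balances the two, however large [c] is. The decay of a
    square would be too weak near zero to absorb such a linear input. *)

Lemma cvg_sumr (R : realType) (T : Type) (F : set_system T) (FF : Filter F)
  (I : finType) (u : I -> T -> R) (l : I -> R) :
  (forall i, u i x @[x --> F] --> l i) ->
  \sum_i u i x @[x --> F] --> \sum_i l i.
Proof.
move=> h; rewrite -(big_enum _ _ _ (fun i => l i)) /=.
have -> : (fun s => \sum_i u i s) = (fun s => \sum_(i <- enum I) u i s).
  by apply/funext => s; rewrite big_enum.
elim: (enum I) => [|i r IH].
  under eq_fun do rewrite big_nil.
  by rewrite big_nil; exact: cvg_cst.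
under eq_fun do rewrite big_cons.
by rewrite big_cons; exact: cvgD.
Qed.

Section Dini.
Context {R : realType}.
Implicit Types (p q : R -> R) (t l : R).

Definition cont_from t0 p t := p s @[s --> within [set s | t0 <= s] (nbhs t)] --> p t.

Definition rderiv p t l := (p s - p t) / (s - t) @[s --> t^'+] --> l.

(** This says that the upper right Dini derivative of [p] at [t] is at most [l]; in epsilon form
    such bounds add up without any limsup. *)
Definition dini_le p t l :=
  forall e, 0 < e -> \forall s \near t^'+, p s - p t <= (l + e) * (s - t).

Lemma rderivP p t l : rderiv p t l <->
  forall e, 0 < e -> \forall s \near t^'+, `|p s - p t - l * (s - t)| <= e * (s - t).
Proof.
split=> [h e e0|h].
  have /cvgrPdist_le/(_ _ e0) hh := h.
  near=> s.
  have st : 0 < s - t by rewrite subr_gt0; near: s; exact: nbhs_right_gt.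
  have : `|l - (p s - p t) / (s - t)| <= e by near: s.
  have -> : l - (p s - p t) / (s - t) = - (p s - p t - l * (s - t)) / (s - t).
    by field; rewrite gt_eqF.
  by rewrite normrM normrN normfV (gtr0_norm st) ler_pdivrMr.
apply/cvgrPdist_le => e e0; near=> s.
have st : 0 < s - t by rewrite subr_gt0; near: s; exact: nbhs_right_gt.
have -> : l - (p s - p t) / (s - t) = - (p s - p t - l * (s - t)) / (s - t).
  by field; rewrite gt_eqF.
rewrite normrM normrN normfV (gtr0_norm st) ler_pdivrMr //.
by near: s; exact: h.
Unshelve. all: by end_near. Qed.

Lemma rderiv_cvg p t l : rderiv p t l -> p s @[s --> t^'+] --> p t.
Proof.
move=> h.
have -> : p t = l * 0 + p t by ring.
apply: (@cvg_trans _ ((fun s => (p s - p t) / (s - t) * (s - t) + p t) @ t^'+)).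
  apply: near_eq_cvg; near=> s.
  have st : 0 < s - t by rewrite subr_gt0; near: s; exact: nbhs_right_gt.
  by field; rewrite gt_eqF.
apply: cvgD; last exact: cvg_cst.
apply: cvgM => //.
rewrite -(subrr t); apply: cvgB; last exact: cvg_cst.
by apply: cvg_within_filter; exact: cvg_id.
Unshelve. all: by end_near. Qed.

Lemma rderiv_cst (k : R) t : rderiv (fun=> k) t 0.
Proof.
rewrite /rderiv.
under eq_fun do rewrite subrr mul0r.
exact: cvg_cst.
Qed.

Lemma rderivD p q t l m : rderiv p t l -> rderiv q t m ->
  rderiv (fun s => p s + q s) t (l + m).
Proof.
move=> hp hq; rewrite /rderiv.
under eq_fun do rewrite opprD addrACA mulrDl.
exact: cvgD.
Qed.

Lemma rderivN p t l : rderiv p t l -> rderiv (fun s => - p s) t (- l).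
Proof.
move=> hp; rewrite /rderiv.
under eq_fun do rewrite -opprD mulNr.
exact: cvgN.
Qed.

Lemma rderivB p q t l m : rderiv p t l -> rderiv q t m ->
  rderiv (fun s => p s - q s) t (l - m).
Proof. by move=> hp hq; apply: rderivD => //; exact: rderivN. Qed.

Lemma rderivZ (k : R) p t l : rderiv p t l -> rderiv (fun s => k * p s) t (k * l).
Proof.
move=> hp; rewrite /rderiv.
under eq_fun do rewrite -mulrBr -mulrA.
by apply: cvgM => //; exact: cvg_cst.
Qed.

Lemma rderivM p q t l m : rderiv p t l -> rderiv q t m ->
  rderiv (fun s => p s * q s) t (l * q t + p t * m).
Proof.
move=> hp hq; rewrite /rderiv.
have -> : (fun s => (p s * q s - p t * q t) / (s - t)) =
  (fun s => (p s - p t) / (s - t) * q s + p t * ((q s - q t) / (s - t))).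
  by apply/funext => s; ring.
apply: cvgD; apply: cvgM => //; first exact: rderiv_cvg hq.
exact: cvg_cst.
Qed.

Lemma rderiv_sum (I : finType) (p : I -> R -> R) t (l : I -> R) :
  (forall i, rderiv (p i) t (l i)) ->
  rderiv (fun s => \sum_i p i s) t (\sum_i l i).
Proof.
move=> h; rewrite /rderiv.
under eq_fun do rewrite -sumrB mulr_suml.
by apply: cvg_sumr => i; exact: h.
Qed.

Lemma rderiv_eq p t l m : rderiv p t l -> l = m -> rderiv p t m.
Proof. by move=> h <-. Qed.

Lemma eq_rderiv p q t l : p =1 q -> rderiv p t l -> rderiv q t l.
Proof. by move=> /funext ->. Qed.

Lemma near_eq_rderiv p q t l : p t = q t ->
  (\forall s \near t^'+, p s = q s) -> rderiv p t l -> rderiv q t l.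
Proof.
move=> pq h /rderivP hp; apply/rderivP => e e0.
near=> s; rewrite -pq.
have <- : p s = q s by near: s.
by near: s; exact: hp.
Unshelve. all: by end_near. Qed.

Lemma rderiv_dini p t l : rderiv p t l -> dini_le p t l.
Proof.
move=> /rderivP h e e0; near=> s.
have : `|p s - p t - l * (s - t)| <= e * (s - t) by near: s; exact: h.
rewrite mulrDl ler_norml => /andP[_]; lra.
Unshelve. all: by end_near. Qed.

Lemma dini_leW p t l m : l <= m -> dini_le p t l -> dini_le p t m.
Proof.
move=> lm h e e0; near=> s.
have st : 0 <= s - t by rewrite subr_ge0 ltW//; near: s; exact: nbhs_right_gt.
apply: (@le_trans _ _ ((l + e) * (s - t))); first by near: s; exact: h.
by rewrite ler_wpM2r// lerD2r.
Unshelve. all: by end_near. Qed.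

Lemma dini_leD p q t l m : dini_le p t l -> dini_le q t m ->
  dini_le (fun s => p s + q s) t (l + m).
Proof.
move=> hp hq e e0; have e2 : 0 < e / 2 by lra.
near=> s.
have : p s - p t <= (l + e / 2) * (s - t) by near: s; exact: hp.
have : q s - q t <= (m + e / 2) * (s - t) by near: s; exact: hq.
move=> h1 h2; apply: (@le_trans _ _ ((m + e / 2) * (s - t) + (l + e / 2) * (s - t))).
  lra.
by rewrite -mulrDl le_eqVlt; apply/orP; left; apply/eqP; field.
Unshelve. all: by end_near. Qed.

Lemma dini_leZ (k : R) p t l : 0 <= k -> dini_le p t l ->
  dini_le (fun s => k * p s) t (k * l).
Proof.
move=> k0 hp e e0; have e2 : 0 < e / (k + 1) by rewrite divr_gt0// ltr_wpDl.
near=> s.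
have st : 0 <= s - t by rewrite subr_ge0 ltW//; near: s; exact: nbhs_right_gt.
have h : p s - p t <= (l + e / (k + 1)) * (s - t) by near: s; exact: hp.
rewrite -mulrBr; apply: le_trans (ler_wpM2l k0 h) _.
rewrite mulrA ler_wpM2r// mulrDr lerD2l mulrCA ler_piMr ?(ltW e0)//.
by rewrite ler_pdivrMr ?ltr_wpDl// mul1r lerDl.
Unshelve. all: by end_near. Qed.

Lemma dini_le_sum (I : finType) (p : I -> R -> R) t (l : I -> R) :
  (forall i, dini_le (p i) t (l i)) ->
  dini_le (fun s => \sum_i p i s) t (\sum_i l i).
Proof.
move=> h; rewrite -(big_enum _ _ _ (fun i => l i)) /=.
have -> : (fun s => \sum_i p i s) = (fun s => \sum_(i <- enum I) p i s).
  by apply/funext => s; rewrite big_enum.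
elim: (enum I) => [|i r IH].
  have -> : (fun s => \sum_(i <- [::]) p i s) = (fun=> 0).
    by apply/funext => s; rewrite big_nil.
  by rewrite big_nil; apply: rderiv_dini; exact: rderiv_cst.
have -> : (fun s => \sum_(j <- i :: r) p j s) = (fun s => p i s + \sum_(j <- r) p j s).
  by apply/funext => s; rewrite big_cons.
by rewrite big_cons; exact: dini_leD.
Qed.


Lemma cont_from_at_right t0 p t : t0 <= t -> cont_from t0 p t -> p s @[s --> t^'+] --> p t.
Proof.
move=> tt; apply: cvg_trans; apply: cvg_app.
move=> A; rewrite /within /at_right /= => -[e /= e0 h].
exists e => //= s /h /=; rewrite /within/= => hs ts; apply: hs.
exact: le_trans (ltW ts).
Qed.

(* Only the last crossing of the barrier [A / (1 + mu (t - t0))] matters: after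
   it [p] would be above the barrier while starting off with a strictly smaller
   right gslope. *)
Lemma dini_decay (t0 t1 A lam : R) p :
  0 < A -> 0 < lam -> t0 <= t1 ->
  (forall t, t0 <= t <= t1 -> cont_from t0 p t) -> p t0 <= A ->
  (forall t, t0 <= t < t1 -> p t <= A -> dini_le p t (- lam * p t)) ->
  p t1 <= A / (1 + lam / 2 * (t1 - t0)).
Proof.
move=> A0 lam0 t01 pc p0 hd; rewrite leNgt; apply/negP => hlt.
(* A hyperbola replaces the exponential: the slope of the barrier [B] is never below
   [- lam / 2 * B t], while [p] falls at rate [lam]. *)
pose D t := 1 + lam / 2 * (t - t0).
pose B t := A / D t.
have Dge t : t0 <= t -> 1 <= D t.
  by move=> tt; rewrite /D lerDl mulr_ge0 ?subr_ge0//; lra.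
have D0 t : t0 <= t -> 0 < D t by move=> /Dge; lra.
have Bc t : t0 <= t -> cont_from t0 B t.
  move=> tt; rewrite /cont_from /B; apply: cvgM; first exact: cvg_cst.
  apply: cvgV; first by rewrite gt_eqF// D0.
  rewrite /D; apply: cvgD; first exact: cvg_cst.
  apply: cvgM; first exact: cvg_cst.
  apply: cvgB; last exact: cvg_cst.
  by apply: cvg_within_filter; exact: cvg_id.
have qc t : t0 <= t <= t1 -> cont_from t0 (fun s => p s - B s) t.
  by move=> /[dup]/andP[tt _] h; apply: cvgB; [exact: pc|exact: Bc].
pose S := [set t | t0 <= t <= t1 /\ p t <= B t].
have S0 : S t0.
  by rewrite /S/= lexx t01; split => //; rewrite /B/D subrr mulr0 addr0 divr1.
have Sn : S !=set0 by exists t0.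
have Su : ubound S t1 by move=> s [/andP[]].
have Sb : has_ubound S by exists t1.
set tau := sup S.
have tau0 : t0 <= tau by exact: ub_le_sup.
have tau1 : tau <= t1 by exact: ge_sup.
have tau01 : t0 <= tau <= t1 by rewrite tau0.
have ptau : p tau <= B tau.
  rewrite leNgt; apply/negP => gtau.
  have e0 : 0 < p tau - B tau by rewrite subr_gt0.
  have /cvgrPdist_lt/(_ _ e0)[d /= d0 hd'] := qc _ tau01.
  have [s Ss ds] := sup_adherent d0 (conj Sn Sb).
  have sle : s <= tau by exact: ub_le_sup.
  case: Ss => /andP[s0 s1] ps.
  have := hd' s; rewrite /ball_/= ger0_norm ?subr_ge0// => /(_ _ s0).
  rewrite ltrBlDl -ltrBlDr -/tau in ds.
  have h : tau - s < d by move: ds; rewrite /tau; lra.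
  move=> /(_ h); rewrite ltNge => /negP; apply.
  by rewrite ler_normr; apply/orP; left; lra.
have tau_lt : tau < t1.
  rewrite lt_neqAle tau1 andbT; apply/eqP => tE.
  by move: ptau; rewrite tE leNgt => /negP; apply.
have above s : tau < s -> s <= t1 -> B s < p s.
  move=> ts s1; rewrite ltNge; apply/negP => ps.
  have : s <= tau by apply: ub_le_sup => //; split => //; rewrite s1 (le_trans tau0)// ltW.
  lra.
have ptauE : p tau = B tau.
  apply/eqP; rewrite eq_le ptau /= -subr_ge0.
  have h := cont_from_at_right tau0 (qc _ tau01).
  apply: (@cvgr_to_ge _ _ _ _ (fun s => p s - B s)) h _.
  near=> s; rewrite subr_ge0 ltW// above//.
    by near: s; exact: nbhs_right_le.
have Btau0 : 0 < B tau by rewrite divr_gt0// D0.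
have pA : p tau <= A.
  by rewrite ptauE /B ler_pdivrMr ?D0// ler_peMr ?Dge// ltW.
have hdt := hd _ _ pA.
(* With the slack [lam / 4], [p] falls just after [tau] with slope at most [- 3 / 4 * lam * B tau],
   faster than the barrier can. *)
have e0 : 0 < lam / 4 * B tau by rewrite mulr_gt0//; lra.
have tau01' : t0 <= tau < t1 by rewrite tau0.
have : \forall s \near tau^'+, False.
  near=> s.
  have ts : tau < s by near: s; exact: nbhs_right_gt.
  have s1 : s <= t1 by near: s; exact: nbhs_right_le.
  have : p s - p tau <= (- lam * p tau + lam / 4 * B tau) * (s - tau).
    by near: s; exact: hdt.
  have /above/(_ s1) hs := ts.
  have s0 : t0 <= s by lra.
  have : B s - B tau >= - (lam / 2) * B tau * (s - tau).
    have -> : B s - B tau = - (lam / 2) * B tau * (s - tau) * (D s)^-1.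
      rewrite /B; have -> : - (lam / 2) * (A / D tau) * (s - tau) = - (D s - D tau) * (A / D tau).
        by rewrite /D; ring.
      by field; rewrite !gt_eqF//; exact: D0.
    have : (D s)^-1 <= 1 by rewrite invf_le1 ?D0// Dge.
    have : 0 <= lam / 2 * B tau * (s - tau) by apply: mulr_ge0; [apply: mulr_ge0; [rewrite divr_ge0 ?(ltW lam0)|exact: ltW]|rewrite subr_ge0 ltW].
    by move: (D s)^-1 => v; nra.
  rewrite ptauE; nra.
by move=> /filter_ex[].
Unshelve. all: by end_near. Qed.

End Dini.

(** A continuity argument: the times up to which [p <= A] has held form an interval containing its
    supremum, and the strict improvement there extends the interval unless it already ends at [t1].
    It turns bounds that are valid only inside a region into unconditional ones. *)
Lemma cont_from_trap (R : realType) (t0 t1 A : R) (p : R -> R) :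
  t0 <= t1 -> (forall t, t0 <= t <= t1 -> cont_from t0 p t) -> p t0 <= A ->
  (forall t, t0 <= t <= t1 -> (forall s, t0 <= s <= t -> p s <= A) -> p t < A) ->
  forall t, t0 <= t <= t1 -> p t < A.
Proof.
move=> t01 pc p0 hA t /andP[tt0 tt1]; apply: (hA t); first by rewrite tt0.
pose S := [set u | t0 <= u <= t1 /\ forall s, t0 <= s <= u -> p s <= A].
have S0 : S t0.
  rewrite /S/= lexx t01; split => // s /andP[s1 s2].
  by rewrite (@le_anti _ _ s t0)// s1 s2.
have Sn : S !=set0 by exists t0.
have Su : ubound S t1 by move=> s [/andP[]].
have Sb : has_ubound S by exists t1.
set tau := sup S.
have tau0 : t0 <= tau by exact: ub_le_sup.
have tau1 : tau <= t1 by exact: ge_sup.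
have tau01 : t0 <= tau <= t1 by rewrite tau0.
have below s : t0 <= s < tau -> p s <= A.
  move=> /andP[s0 st]; have d0 : 0 < tau - s by rewrite subr_gt0.
  have [u [_ hu] us] := sup_adherent d0 (conj Sn Sb).
  by apply: hu; rewrite s0/= ltW//; move: us; rewrite -/tau; lra.
have ptau : p tau <= A.
  rewrite leNgt; apply/negP => gtau.
  have tau_gt : t0 < tau.
    by rewrite lt_neqAle tau0 andbT; apply/eqP => tE; move: gtau; rewrite -tE ltNge p0.
  have e0 : 0 < p tau - A by rewrite subr_gt0.
  have /cvgrPdist_lt/(_ _ e0)[e /= e1 he] := pc _ tau01.
  pose s := Num.max t0 (tau - e / 2).
  have s0 : t0 <= s by rewrite /s le_max lexx.
  have st : s < tau by rewrite /s gt_max tau_gt; lra.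
  have se : tau - e / 2 <= s by rewrite /s le_max lexx orbT.
  have h1 : p s <= A by apply: below; rewrite s0.
  have : `|tau - s| < e by rewrite ger0_norm; lra.
  move=> /he /(_ s0); rewrite ltNge => /negP; apply.
  by rewrite ler_normr; apply/orP; left; lra.
have hS s : t0 <= s <= tau -> p s <= A.
  move=> /andP[s0]; rewrite le_eqVlt => /orP[/eqP ->//|st].
  by apply: below; rewrite s0.
have ptau' := hA _ tau01 hS.
case: (eqVneq tau t1) => [te|ne].
  by move=> s /andP[s0 st]; apply: hS; rewrite s0 te (le_trans st).
exfalso.
have tau_lt : tau < t1 by rewrite lt_neqAle ne.
have e0 : 0 < A - p tau by rewrite subr_gt0.
have /cvgrPdist_lt/(_ _ e0)[e /= e1 he] := pc _ tau01.
pose u := Num.min t1 (tau + e / 2).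
have ut : tau < u by rewrite /u lt_min tau_lt; lra.
have u1 : u <= t1 by rewrite /u ge_min lexx.
have ue : u <= tau + e / 2 by rewrite /u ge_min lexx orbT.
have : u <= tau.
  apply: ub_le_sup => //; split; first by rewrite u1 andbT; lra.
  move=> s /andP[s0 su]; case: (leP s tau) => st; first by apply: hS; rewrite s0.
  have : `|tau - s| < e by rewrite ler0_norm; lra.
  move=> /he /(_ s0); rewrite ltr_norml => /andP[]; lra.
lra.
Qed.

(** * Functions of class C1 of several variables *)

Section Calculus.
Context {R : realType}.

(** A parameter in [[0, 1]] treats [a < b], [a > b] and [a = b] alike; coordinate increments have no
    fixed sign. *)
Lemma MVT_convex (p dp : R -> R) (a b : R) :
  (forall r : R, is_derive r 1 p (dp r)) ->
  exists s, 0 <= s <= 1 /\ p b - p a = dp (a + s * (b - a)) * (b - a).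
Proof.
move=> hp.
have pc r : {for r, continuous p}.
  by apply: differentiable_continuous; apply/derivable1_diffP; case: (hp r).
have pw (u v : R) : {within `[u, v], continuous p}.
  by apply: continuous_subspaceT => r; exact: pc.
case: (ltgtP a b) => [ab|ba|->]; last by exists 0; rewrite !subrr mulr0 lexx ler01.
- have [c /andP[]] := MVT ab (fun r _ => hp r) (@pw a b).
  rewrite !bnd_simp => ac cb ->; exists ((c - a) / (b - a)).
  rewrite divfK ?subr_eq0 ?gt_eqF// (addrC a) subrK; split => //.
  apply/andP; split; first by rewrite divr_ge0 ?subr_ge0 ?(ltW ab) ?(ltW ac).
  by rewrite ler_pdivrMr ?subr_gt0// mul1r lerD2r ltW.
- have [c /andP[]] := MVT ba (fun r _ => hp r) (@pw b a).
  rewrite !bnd_simp => bc ca e; exists ((a - c) / (a - b)); split.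
    apply/andP; split; first by rewrite divr_ge0 ?subr_ge0 ?(ltW ba) ?(ltW ca).
    by rewrite ler_pdivrMr ?subr_gt0// mul1r lerD2l lerN2 ltW.
  have -> : a + (a - c) / (a - b) * (b - a) = c by field; rewrite subr_eq0 gt_eqF.
  by rewrite -(opprB (p a)) e; ring.
Qed.

Context {N : nat}.
Implicit Types (h : 'rV[R]_N -> R) (x : 'rV[R]_N) (i j : 'I_N).

Lemma is_derive_line h x j (r : R) : C1 h ->
  is_derive r 1 (fun r : R => h (x + r *: 'e_j)) (partial j h (x + r *: 'e_j)).
Proof.
move=> /(_ j)[hd _]; have := hd (x + r *: 'e_j).
have E : (fun k : R => k^-1 *: (((fun r => h (x + r *: 'e_j)) \o shift r) (k *: 1) - h (x + r *: 'e_j)))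
  = (fun k : R => k^-1 *: ((h \o shift (x + r *: 'e_j)) (k *: 'e_j) - h (x + r *: 'e_j))).
  apply/funext => k /=; congr (_ *: (h _ - _)).
  by rewrite [k *: 1]mulr1 scalerDl addrCA addrC.
move=> hd'; split; first by rewrite /derivable E.
by rewrite /derive E.
Qed.

(* The increment is telescoped along the points that agree with [x'] in the
   first [k] coordinates and with [x] in the others. *)
Lemma C1_increment h x x' : C1 h ->
  exists q : 'I_N -> 'rV[R]_N,
    (forall j k, exists s, 0 <= s <= 1 /\
       q j 0 k = x 0 k + s * (x' 0 k - x 0 k)) /\
    h x' - h x = \sum_j partial j h (q j) * (x' 0 j - x 0 j).
Proof.
move=> hC.
pose X (k : nat) : 'rV[R]_N := \row_j (if (j < k)%N then x' 0 j else x 0 j).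
have step j : exists q : 'rV[R]_N, (forall k, exists s, 0 <= s <= 1 /\
       q 0 k = x 0 k + s * (x' 0 k - x 0 k)) /\
     h (X j.+1) - h (X j) = partial j h q * (x' 0 j - x 0 j).
  have [s [s01 hs]] := MVT_convex 0 (x' 0 j - x 0 j) (fun r => is_derive_line (X j) j r hC).
  move: hs; rewrite subr0 scale0r addr0.
  have -> : X j + (x' 0 j - x 0 j) *: 'e_j = X j.+1.
    apply/rowP => k; rewrite !mxE eqxx /= ltnS -val_eqE/=.
    case: (ltngtP (k : nat) j) => /= kj; rewrite ?mulr0 ?addr0 ?mulr1 //.
    by rewrite (val_inj kj) addrC subrK.
  move=> ->; eexists; split; last by reflexivity.
  move=> k; rewrite !mxE eqxx /= -val_eqE/=.
  case: (ltngtP (k : nat) j) => /= kj; rewrite ?mulr0 ?addr0 ?mulr1.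
  - by exists 1; rewrite ler01 lexx mul1r addrC subrK.
  - by exists 0; rewrite ler01 lexx mul0r addr0.
  - by rewrite (val_inj kj); exists s; rewrite add0r.
have [q hq] := choice step; exists q; split; first by move=> j; exact: (hq j).1.
have -> : x' = X N by apply/rowP => j; rewrite !mxE ltn_ord.
have -> : h x = h (X 0%N) by congr h; apply/rowP => j; rewrite !mxE.
rewrite -(telescope_sumr (fun k => h (X k)) (leq0n N)) big_mkord.
by apply: eq_bigr => j _; rewrite (hq j).2 !mxE ltn_ord.
Qed.

(** The intermediate points of [C1_increment] stay in the box, each coordinate being a convex
    combination. The coordinatewise increments produce the l1 norm, hence the sums of absolute
    values in the later estimates. *)
Lemma C1_lip h (r B : R) x x' : C1 h ->
  (forall j (z : 'rV[R]_N), (forall k, `|z 0 k| <= r) -> `|partial j h z| <= B) ->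
  (forall k, `|x 0 k| <= r) -> (forall k, `|x' 0 k| <= r) ->
  `|h x' - h x| <= B * \sum_j `|x' 0 j - x 0 j|.
Proof.
move=> hC hB hx hx'; have [q [hq ->]] := C1_increment x x' hC.
apply: le_trans (ler_norm_sum _ _ _) _; rewrite mulr_sumr; apply: ler_sum => j _.
rewrite normrM ler_wpM2r// hB// => k.
have [s [/andP[s0 s1] ->]] := hq j k.
have -> : x 0 k + s * (x' 0 k - x 0 k) = (1 - s) * x 0 k + s * x' 0 k by ring.
apply: le_trans (ler_normD _ _) _; rewrite !normrM (ger0_norm s0) ger0_norm; last lra.
by have := hx k; have := hx' k; nra.
Qed.

Lemma cvg_rV (T : Type) (F : set_system T) (FF : Filter F) (u : T -> 'rV[R]_N) x :
  (forall k, u s 0 k @[s --> F] --> x 0 k) -> u s @[s --> F] --> x.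
Proof.
move=> hu; apply/cvgrPdist_lt => e e0.
have : \forall s \near F, forall k : 'I_N, `|x 0 k - u s 0 k| < e.
  by apply: filter_forall => k; have /cvgrPdist_lt := hu k; exact.
apply: filterS => s hs.
rewrite /Num.norm/= mx_normrE; apply/bigmax_ltP; split => //= -[i k] _ /=.
by rewrite !mxE ord1.
Qed.

(** [C1] speaks of partial derivatives only; continuity of [h] itself is recovered from the
    increment formula, whose intermediate points converge to [x]. *)
Lemma C1_cvg h (T : Type) (F : set_system T) (FF : Filter F) (u : T -> 'rV[R]_N) x :
  C1 h -> (forall k, u s 0 k @[s --> F] --> x 0 k) -> h (u s) @[s --> F] --> h x.
Proof.
move=> hC hu.
have /choice[q hq] := fun s => C1_increment x (u s) hC.
have qc j k : q s j 0 k @[s --> F] --> x 0 k.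
  apply/cvgrPdist_le => e e0.
  have /cvgrPdist_le/(_ _ e0) := hu k; apply: filterS => s.
  have [t [/andP[t0 t1] ->]] := (hq s).1 j k.
  move=> he; rewrite opprD addNKr normrN normrM (ger0_norm t0) distrC in he *.
  by rewrite (le_trans _ he)// ler_piMl.
have -> : h x = \sum_j partial j h x * (x 0 j - x 0 j) + h x.
  by rewrite big1 ?add0r// => j _; rewrite subrr mulr0.
have -> : (fun s => h (u s)) =
    (fun s => \sum_j partial j h (q s j) * (u s 0 j - x 0 j) + h x).
  by apply/funext => s; rewrite -(hq s).2 subrK.
apply: cvgD; last exact: cvg_cst.
apply: cvg_sumr => j; apply: cvgM; last by apply: cvgB; [exact: hu|exact: cvg_cst].
have [_ hj] := hC j.
by apply: continuous_cvg; [exact: hj|exact: cvg_rV].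
Qed.

(** Chain rule along a curve that is only right differentiable, again from the increment formula:
    the quotients of the coordinates multiply partials at points that tend to [u t]. *)
Lemma C1_rderiv h (u : R -> 'rV[R]_N) t (l : 'I_N -> R) : C1 h ->
  (forall k, rderiv (fun s => u s 0 k) t (l k)) ->
  rderiv (fun s => h (u s)) t (\sum_j partial j h (u t) * l j).
Proof.
move=> hC hu.
have /choice[q hq] := fun s => C1_increment (u t) (u s) hC.
have qc j k : q s j 0 k @[s --> t^'+] --> u t 0 k.
  apply/cvgrPdist_le => e e0.
  have /cvgrPdist_le/(_ _ e0) := rderiv_cvg (hu k); apply: filterS => s.
  have [v [/andP[v0 v1] ->]] := (hq s).1 j k.
  move=> he; rewrite opprD addNKr normrN normrM (ger0_norm v0) distrC in he *.
  by rewrite (le_trans _ he)// ler_piMl.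
rewrite /rderiv.
have -> : (fun s => (h (u s) - h (u t)) / (s - t)) =
    (fun s => \sum_j partial j h (q s j) * ((u s 0 j - u t 0 j) / (s - t))).
  apply/funext => s; rewrite (hq s).2 mulr_suml.
  by apply: eq_bigr => j _; rewrite mulrA.
apply: cvg_sumr => j; apply: cvgM; last exact: hu.
have [_ hj] := hC j.
by apply: continuous_cvg; [exact: hj|exact: cvg_rV].
Qed.

Lemma continuous_bounded_box h (r : R) : continuous h ->
  exists B, forall x, (forall k : 'I_N, `|x 0 k| <= r) -> `|h x| <= B.
Proof.
move=> hc.
pose K := [set x : 'rV[R]_N | forall k, [set` `[- r, r]%R] (x 0 k)].
have Kc : compact K by apply: (@rV_compact _ _ (fun=> [set` `[- r, r]%R])) => k; exact: segment_compact.
have : compact (h @` K).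
  by apply: continuous_compact => //; exact: continuous_subspaceT.
move=> /compact_bounded[M [Mr hM]].
exists (M + 1) => x hx; apply: (hM (M + 1)); first by rewrite ltrDl.
exists x => // k; rewrite /= in_itv /= -ler_norml; exact: hx.
Qed.

End Calculus.

(** * Coercivity of the pinned graph Laplacian *)

Section Graph.
Context {R : realType} {N : nat} (a : 'M[R]_N).
Hypotheses (aw : weighted_graph a) (au : undirected a) (ac : connected_graph a).

(** The quadratic form of the graph Laplacian plus the diagonal matrix of the weights [a i j]. It
    governs the estimates that all players hold of the action of player [j]. *)
Definition pinned_form (j : 'I_N) (v : 'I_N -> R) : R :=
  \sum_i v i * (\sum_k a i k * (v i - v k) + a i j * v i).

(** Symmetry of [a] allows averaging the Laplacian part with its copy under exchange of the two
    indices, which produces the squares over edges. *)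
Lemma pinned_formE j v : pinned_form j v =
  2^-1 * (\sum_i \sum_k a i k * (v i - v k) ^+ 2) + \sum_i a i j * v i ^+ 2.
Proof.
have E : \sum_i \sum_k a i k * (v i - v k) ^+ 2 =
    2 * \sum_i v i * (\sum_k a i k * (v i - v k)).
  transitivity (\sum_i \sum_k a i k * (v i * (v i - v k)) +
                \sum_i \sum_k a i k * (v k * (v k - v i))).
    rewrite -big_split; apply: eq_bigr => i _; rewrite -big_split /=.
    by apply: eq_bigr => k _; ring.
  rewrite [X in _ + X]exchange_big /=.
  have -> : \sum_j \sum_i a i j * (v j * (v j - v i)) =
            \sum_i \sum_k a i k * (v i * (v i - v k)).
    by apply: eq_bigr => i _; apply: eq_bigr => k _; rewrite au.
  have -> : \sum_i \sum_k a i k * (v i * (v i - v k)) =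
            \sum_i v i * (\sum_k a i k * (v i - v k)).
    by apply: eq_bigr => i _; rewrite mulr_sumr; apply: eq_bigr => k _; ring.
  ring.
rewrite E mulKf ?pnatr_eq0// -big_split; apply: eq_bigr => i _ /=; ring.
Qed.

Lemma ler_term (I : finType) (F : I -> R) i : (forall k, 0 <= F k) -> F i <= \sum_k F k.
Proof. by move=> F0; rewrite (bigD1 i)//= lerDl sumr_ge0. Qed.

Lemma pinned_edge j v i k : a i k * (v i - v k) ^+ 2 <= 2 * pinned_form j v.
Proof.
have [a0 _] := aw.
have n2 i' k' : 0 <= a i' k' * (v i' - v k') ^+ 2 by rewrite mulr_ge0 ?sqr_ge0.
have := ler_term k (n2 i).
have n1 i' : 0 <= \sum_k a i' k * (v i' - v k) ^+ 2 by exact: sumr_ge0.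
have := ler_term i n1.
have : 0 <= \sum_i a i j * v i ^+ 2 by apply: sumr_ge0 => i' _; rewrite mulr_ge0 ?sqr_ge0.
rewrite pinned_formE; lra.
Qed.

Lemma pinned_pin j v i : a i j * v i ^+ 2 <= pinned_form j v.
Proof.
have [a0 _] := aw.
have n2 i' : 0 <= a i' j * v i' ^+ 2 by rewrite mulr_ge0 ?sqr_ge0.
have := ler_term i n2.
have : 0 <= \sum_i \sum_k a i k * (v i - v k) ^+ 2.
  by apply: sumr_ge0 => i' _; apply: sumr_ge0 => k _; rewrite mulr_ge0 ?sqr_ge0.
rewrite pinned_formE; lra.
Qed.

(** Connectedness and [2 <= N] give [j] a neighbour, whose value is bounded by the pinning term. The
    bound is then passed along a path to [i], each edge controlling one difference. *)
Lemma pinned_node j i : (2 <= N)%N ->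
  exists C, 0 <= C /\ forall v, v i ^+ 2 <= C * pinned_form j v.
Proof.
move=> N2; pose e := fun k l : 'I_N => 0 < a k l.
have [k ajk] : exists k, e j k.
  have [l lj] : exists l : 'I_N, l != j.
    apply/existsP; rewrite -[X in is_true X]negbK negb_exists; apply/negP => /forallP h.
    have : (#|'I_N| <= 1)%N.
      apply/fintype_le1P => x y; have := h x; have := h y.
      by rewrite !negbK => /eqP -> /eqP ->.
    by rewrite card_ord leqNgt N2.
  have /connectP[[|k p] /=] := ac j l; first by move=> _ lE; rewrite lE eqxx in lj.
  by move=> /andP[ek _] _; exists k.
have /connectP[p] := ac k i.
have : exists C, 0 <= C /\ forall v, v k ^+ 2 <= C * pinned_form j v.
  exists (a k j)^-1; rewrite au invr_ge0 ltW//; split => // v.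
  by rewrite mulrC ler_pdivlMr// mulrC -(au k j) pinned_pin.
elim: p k {ajk} => [|l p IH] k [C [C0 hC]] /=; first by move=> _ ->; exists C.
move=> /andP[akl pl] iE; apply: (IH l _ pl iE).
(* From [v l ^+ 2 <= 2 * v k ^+ 2 + 2 * (v k - v l) ^+ 2]; [pinned_edge] contributes another factor
   2. *)
exists (2 * C + 4 * (a k l)^-1); split.
  by rewrite addr_ge0// mulr_ge0// invr_ge0 ltW.
move=> v; have h1 := hC v.
have h2 : (v k - v l) ^+ 2 <= (a k l)^-1 * (2 * pinned_form j v).
  by rewrite mulrC ler_pdivlMr// mulrC pinned_edge.
have : 0 <= (v k + (v k - v l)) ^+ 2 by exact: sqr_ge0.
nra.
Qed.

Lemma pinned_coercive : (2 <= N)%N ->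
  exists lam, 0 < lam /\
    forall j v, lam * \sum_i v i ^+ 2 <= pinned_form j v.
Proof.
move=> N2.
have /choice[C hC] : forall ij : 'I_N * 'I_N, exists C, 0 <= C /\
    forall v, v ij.1 ^+ 2 <= C * pinned_form ij.2 v.
  by move=> ij; exact: pinned_node.
pose K := \sum_ij C ij + 1.
have K0 : 0 < K by rewrite ltr_wpDl// sumr_ge0// => ij _; exact: (hC ij).1.
exists K^-1; rewrite invr_gt0; split => // j v.
have P0 : 0 <= pinned_form j v.
  have := @pinned_edge j v j j; rewrite subrr expr0n/= mulr0; lra.
rewrite ler_pdivrMl//.
apply: (@le_trans _ _ (\sum_i C (i, j) * pinned_form j v)).
  by apply: ler_sum => i _; exact: (hC (i, j)).2.
rewrite -mulr_suml ler_wpM2r// /K ler_wpDr//.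
have -> : \sum_ij C ij = \sum_i \sum_j C (i, j).
  by rewrite pair_bigA /=; apply: eq_bigr => -[].
apply: ler_sum => i _.
by apply: (@ler_term _ (fun j => C (i, j))) => k; exact: (hC (i, k)).1.
Qed.

End Graph.

(** * Filippov solutions and the robust integral term *)

Section Rise.
Context {R : realType}.
Local Notation mu := (@lebesgue_measure R).

(** The bounds are asked on []t, t']] only, since the selection at [t] may differ from its values
    just after [t]. *)
Lemma Rintegral_increment (t0 t t' : R) (phi s : R -> R) (b lo hi : R) :
  t0 <= t -> t < t' ->
  {within `[t0, t'], continuous phi} -> measurable_fun `[t0, t'] s ->
  (forall r, t0 <= r <= t' -> `|s r| <= 1) ->
  (forall r, t < r <= t' -> lo <= phi r + b * s r <= hi) ->
  lo * (t' - t) <= \int[mu]_(r in `[t0, t']) (phi r + b * s r)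
    - \int[mu]_(r in `[t0, t]) (phi r + b * s r) <= hi * (t' - t).
Proof.
move=> t0t tt' phic ms s1 hb.
have mE : measurable `[t0, t']%classic by exact: measurable_itv.
have muE (u v : R) : (mu `[u, v] < +oo)%E.
  by rewrite lebesgue_measure_itv/=; case: ifP => // _; rewrite -EFinB ltry.
have iphi : mu.-integrable `[t0, t'] (EFin \o phi).
  by apply: continuous_compact_integrable => //; exact: segment_compact.
have is_ : mu.-integrable `[t0, t'] (EFin \o s).
  apply: measurable_bounded_integrable => //; first exact: muE.
  exists 1; split; rewrite ?num_real// => x x1 r /=.
  by rewrite in_itv/= => /s1 /le_trans; apply; exact: ltW.
have ii : mu.-integrable `[t0, t'] (EFin \o (fun r => phi r + b * s r)).
  have -> : (EFin \o (fun r => phi r + b * s r)) = (EFin \o phi \+ (fun r => b%:E * (EFin \o s) r))%E.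
    by apply/funext => r /=; rewrite EFinD EFinM.
  by apply: integrableD => //; exact: integrableZl.
rewrite (_ : \int[_]_(_ in _) _ - _ = \int[mu]_(r in `]t, t']) (phi r + b * s r)); last first.
  by rewrite Rintegral_itvB//= bnd_simp ltW.
have sub : `]t, t'] `<=` `[t0, t'].
  by move=> r /=; rewrite !in_itv/= => /andP[h ->]; rewrite (le_trans t0t (ltW h)).
have ii' : mu.-integrable `]t, t'] (EFin \o (fun r => phi r + b * s r)).
  by apply: integrableS ii => //; exact: measurable_itv.
have ik (k : R) : mu.-integrable `]t, t'] (EFin \o (fun=> k)).
  have : mu.-integrable `[t0, t'] (EFin \o (fun=> k)); last first.
    by apply: integrableS => //; exact: measurable_itv.
  apply: continuous_compact_integrable; first exact: segment_compact.
  by apply: continuous_subspaceT => x; exact: cvg_cst.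
have ck (k : R) : \int[mu]_(r in `]t, t']) k = k * (t' - t).
  have m_itv : mu `]t, t']%classic = (t' - t)%:E.
    by rewrite lebesgue_measure_itv/= lte_fin tt'.
  rewrite (_ : t' - t = fine (mu `]t, t']%classic)); last by rewrite m_itv.
  by apply: Rintegral_cst; exact: measurable_itv.
rewrite -!ck; apply/andP; split; apply: le_Rintegral => // r /=; rewrite in_itv/=.
  by move=> /hb /andP[].
by move=> /hb /andP[].
Qed.

(** While [ze] is positive, [- b * om] from the square cancels against [b * om] from [b * |ze|].
    Producing this cancellation is the purpose of the term [b * |ze|] in the energy. *)
Lemma rise_dini_pos (om ze : R -> R) (t A de b c : R) :
  rderiv ze t (om t + de - c * ze t) ->
  rderiv om t (A - b) -> (\forall s \near t^'+, 0 < ze s) ->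
  0 <= b ->
  dini_le (fun s => om s ^+ 2 / 2 + b * `|ze s|) t
    (om t * A + b * `|de| - c * b * `|ze t|).
Proof.
move=> hz ho pos b0.
have zt : 0 <= ze t.
  apply: (@cvgr_to_ge _ _ _ _ ze) (rderiv_cvg hz) _.
  by apply: filterS pos => s /ltW.
apply: (@dini_leW _ _ _ (om t * (A - b) + b * (om t + de - c * ze t))).
  rewrite (ger0_norm zt).
  have : b * de <= b * `|de| by rewrite ler_wpM2l// ler_norm.
  lra.
apply: rderiv_dini.
apply: (@near_eq_rderiv _ (fun s => om s ^+ 2 / 2 + b * ze s)).
- by rewrite ger0_norm.
- by apply: filterS pos => s /ltW s0; rewrite ger0_norm.
apply: rderivD; last exact: rderivZ.
apply: (@eq_rderiv _ (fun s => 2^-1 * (om s * om s))); first by move=> s; ring.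
by apply: (rderiv_eq (rderivZ (k := 2^-1) (rderivM ho ho))); field.
Qed.

(* At a zero of [ze] with vanishing right derivative [om t + de], the term
   [- b * om t * sgn] is at most [b * `|om t| = b * `|de|], whatever selection
   of the signum is used. *)
Lemma rise_dini_energy (om ze : R -> R) (t A de b c : R) :
  rderiv ze t (om t + de - c * ze t) ->
  (forall e, 0 < e ->
    \forall s \near t^'+, `|om s - om t - A * (s - t)| <= (b + e) * (s - t)) ->
  ((\forall s \near t^'+, 0 < ze s) -> rderiv om t (A - b)) ->
  ((\forall s \near t^'+, ze s < 0) -> rderiv om t (A + b)) ->
  0 <= b ->
  dini_le (fun s => om s ^+ 2 / 2 + b * `|ze s|) t
    (om t * A + b * `|de| - c * b * `|ze t|).
Proof.
move=> hz ho hp hn b0.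
have posc : (\forall s \near t^'+, 0 < ze s) -> dini_le (fun s => om s ^+ 2 / 2 + b * `|ze s|) t
    (om t * A + b * `|de| - c * b * `|ze t|).
  by move=> h; apply: rise_dini_pos => //; exact: hp.
have negc : (\forall s \near t^'+, ze s < 0) -> dini_le (fun s => om s ^+ 2 / 2 + b * `|ze s|) t
    (om t * A + b * `|de| - c * b * `|ze t|).
  move=> h.
  have hz' : rderiv (fun s => - ze s) t (- om t + (- de) - c * (- ze t)).
    apply: (rderiv_eq (rderivN hz)); ring.
  have ho' : rderiv (fun s => - om s) t (- A - b).
    apply: (rderiv_eq (rderivN (hn h))); ring.
  have h' : \forall s \near t^'+, 0 < - ze s.
    by apply: filterS h => s; rewrite oppr_gt0.
  have := rise_dini_pos hz' ho' h' b0.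
  rewrite !normrN mulrNN.
  by under eq_fun do rewrite sqrrN normrN.
have zc := rderiv_cvg hz.
case: (ltgtP 0 (ze t)) => [zt|zt|zt].
- by apply: posc; exact: (cvgr_gt (ze t)).
- by apply: negc; exact: (cvgr_lt (ze t)).
(* At a zero of [ze], [d] is its right derivative. If [d] is nonzero, [ze] has a sign just after [t]
   and the previous cases apply; only [d = 0] is new. *)
pose d := om t + de.
have /rderivP hz' : rderiv ze t d by apply: (rderiv_eq hz); rewrite -zt mulr0 subr0.
case: (ltgtP 0 d) => d0.
- apply: posc; have e0 : 0 < d / 2 by lra.
  near=> s.
  have st : 0 < s - t by rewrite subr_gt0; near: s; exact: nbhs_right_gt.
  have : `|ze s - ze t - d * (s - t)| <= d / 2 * (s - t) by near: s; exact: hz'.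
  rewrite -zt ler_norml => /andP[h _].
  have : 0 < d / 2 * (s - t) by rewrite mulr_gt0.
  lra.
- apply: negc; have e0 : 0 < - d / 2 by lra.
  near=> s.
  have st : 0 < s - t by rewrite subr_gt0; near: s; exact: nbhs_right_gt.
  have : `|ze s - ze t - d * (s - t)| <= - d / 2 * (s - t) by near: s; exact: hz'.
  rewrite -zt ler_norml => /andP[_ h].
  have : 0 < - d / 2 * (s - t) by rewrite mulr_gt0.
  lra.
rewrite -zt normr0 mulr0 subr0 => e e0.
have -> : `|de| = `|om t| by rewrite -normrN; congr (`|_|); move: d0; rewrite /d; lra.
(* The tolerance makes the errors of [om], multiplied by [|om t|], and of [ze], multiplied by [b],
   cost at most [e / 4] together. *)
pose k := e / (4 * (`|om t| + b + 1)).
have k0 : 0 < k by rewrite divr_gt0// mulr_gt0// ltr_wpDl// addr_ge0.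
have kE : k * (`|om t| + b + 1) = e / 4.
  by rewrite /k; field; rewrite gt_eqF// ltr_wpDl// addr_ge0.
(* [M] bounds the growth rate of [om] to the right of [t], so that [(om s - om t) ^+ 2] is of second
   order in [s - t]. *)
pose M := `|A| + b + k.
have M0 : 0 < M by rewrite ltr_wpDl// addr_ge0.
have d1 : 0 < e / (2 * M ^+ 2) by rewrite divr_gt0// mulr_gt0// exprn_gt0.
near=> s.
have st : 0 < s - t by rewrite subr_gt0; near: s; exact: nbhs_right_gt.
have h1 : `|om s - om t - A * (s - t)| <= (b + k) * (s - t) by near: s; exact: ho.
have : `|ze s - ze t - d * (s - t)| <= k * (s - t) by near: s; exact: hz'.
rewrite -d0 -zt mul0r !subr0 => h2.
have h3 : s - t < e / (2 * M ^+ 2) by near: s; exact: nbhs_right_ltDr.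
have h4 : `|om s - om t| <= M * (s - t).
  rewrite -(subrK (A * (s - t)) (om s - om t)) (le_trans (ler_normD _ _))//.
  rewrite normrM (gtr0_norm st) /M; nra.
rewrite /= -?zt ?normr0 ?mulr0 ?addr0.
have h5 : (om s - om t) ^+ 2 <= e / 2 * (s - t).
  rewrite -real_normK ?num_real//.
  apply: (@le_trans _ _ ((M * (s - t)) ^+ 2)).
    by rewrite lerXn2r// nnegrE// mulr_ge0// ltW.
  move: h3; rewrite ltr_pdivlMr ?mulr_gt0 ?exprn_gt0// => h3.
  rewrite exprMn expr2 mulrA ler_wpM2r ?(ltW st)//; lra.
have h6 : om t * (om s - om t - A * (s - t)) <= `|om t| * ((b + k) * (s - t)).
  by rewrite (le_trans (ler_norm _))// normrM ler_wpM2l.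
have h7 : b * `|ze s| <= b * (k * (s - t)) by rewrite ler_wpM2l.
have h8 : k * (`|om t| + b + 1) * (s - t) = e / 4 * (s - t) by rewrite kE.
have h9 : 0 <= k * (s - t) by rewrite mulr_ge0// ltW.
have -> : om s ^+ 2 / 2 + b * `|ze s| - om t ^+ 2 / 2 =
  om t * (om s - om t - A * (s - t)) + om t * A * (s - t)
  + (om s - om t) ^+ 2 / 2 + b * `|ze s| by field.
have : 0 < e * (s - t) by rewrite mulr_gt0.
lra.
Unshelve. all: by end_near. Qed.

(** In the application [A] contains [h0 t], which does not vanish with the observation errors. The
    derivative of [- ze * h0] contains [- h0 t * om t], which cancels [om t * h0 t]; all that it
    leaves carries a factor [de] or [ze]. *)
Lemma rise_dini (om ze h0 : R -> R) (t A de b c H1 : R) :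
  rderiv ze t (om t + de - c * ze t) ->
  (forall e, 0 < e ->
    \forall s \near t^'+, `|om s - om t - A * (s - t)| <= (b + e) * (s - t)) ->
  ((\forall s \near t^'+, 0 < ze s) -> rderiv om t (A - b)) ->
  ((\forall s \near t^'+, ze s < 0) -> rderiv om t (A + b)) ->
  0 <= b ->
  (\forall s \near t^'+, `|h0 s - h0 t| <= H1 * (s - t)) ->
  dini_le (fun s => om s ^+ 2 / 2 + b * `|ze s| - ze s * h0 s) t
    (om t * A + b * `|de| - c * b * `|ze t|
     + (- h0 t * (om t + de - c * ze t) + H1 * `|ze t|)).
Proof.
move=> hz ho hp hn b0 hl; apply: dini_leD; first exact: rise_dini_energy.
move=> e e0.
set d := om t + de - c * ze t in hz *.
have /rderivP hz' := hz.
have k0 : 0 < e / (2 * (`|h0 t| + 1)) by rewrite divr_gt0// mulr_gt0// ltr_wpDl.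
have l0 : 0 < e / (2 * (`|H1| + 1)) by rewrite divr_gt0// mulr_gt0// ltr_wpDl.
have /cvgrPdist_le/(_ _ l0) zc := rderiv_cvg hz.
near=> s.
have st : 0 < s - t by rewrite subr_gt0; near: s; exact: nbhs_right_gt.
have h1 : `|ze s - ze t - d * (s - t)| <= e / (2 * (`|h0 t| + 1)) * (s - t) by near: s; exact: hz'.
have h2 : `|ze t - ze s| <= e / (2 * (`|H1| + 1)) by near: s.
have h3 : `|h0 s - h0 t| <= H1 * (s - t) by near: s.
have h4 : - h0 t * (ze s - ze t - d * (s - t)) <= e / 2 * (s - t).
  rewrite (le_trans (ler_norm _))// normrM normrN.
  apply: (le_trans (ler_wpM2l (normr_ge0 _) h1)).
  rewrite mulrA ler_wpM2r ?(ltW st)// mulrC mulrAC ler_pdivrMr ?mulr_gt0 ?ltr_wpDl//.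
  have := normr_ge0 (h0 t); nra.
have h5 : - ze s * (h0 s - h0 t) <= `|ze s| * (H1 * (s - t)).
  by rewrite (le_trans (ler_norm _))// normrM normrN ler_wpM2l.
have H10 : 0 <= H1.
  by move: (le_trans (normr_ge0 _) h3); rewrite pmulr_lge0.
have h6 : `|ze s| * (H1 * (s - t)) <= (H1 * `|ze t| + e / 2) * (s - t).
  rewrite mulrA ler_wpM2r ?(ltW st)//.
  have : `|ze s| <= `|ze t| + `|ze t - ze s|.
    by rewrite -{1}(subKr (ze t) (ze s)) (le_trans (ler_normB _ _)).
  move=> h7; have : `|ze t - ze s| * H1 <= e / 2.
    apply: (le_trans (ler_wpM2r H10 h2)).
    rewrite mulrAC ler_pdivrMr ?mulr_gt0 ?ltr_wpDl// (ger0_norm H10); nra.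
  have : `|ze s| * H1 <= (`|ze t| + `|ze t - ze s|) * H1 by rewrite ler_wpM2r.
  lra.
have -> : - (ze s * h0 s) - - (ze t * h0 t) =
  - h0 t * (ze s - ze t - d * (s - t)) - ze s * (h0 s - h0 t)
  + - h0 t * d * (s - t) by ring.
lra.
Unshelve. all: by end_near. Qed.

End Rise.

(** * From the closed-loop equations to right derivatives and to increments of the integral state *)

Section Bridge.
Context {R : realType}.
Local Notation mu := (@lebesgue_measure R).

Lemma has_deriv_from_rderiv (t0 : R) p t l : t0 <= t -> has_deriv_from t0 p t l -> rderiv p t l.
Proof.
move=> tt; apply: cvg_trans; apply: cvg_app.
move=> A; rewrite /within /at_right /dnbhs /= => -[e /= e0 h].
exists e => //= s /h /=; rewrite /within/= => hs ts; apply: hs.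
  by rewrite gt_eqF.
exact: le_trans (ltW ts).
Qed.

Lemma lipschitz_cont_from (t0 C : R) p t :
  (\forall s \near within [set s | t0 <= s] (nbhs t), `|p s - p t| <= C * `|s - t|) ->
  cont_from t0 p t.
Proof.
move=> h; apply/cvgrPdist_le => e e0.
pose k := e / (`|C| + 1).
have k0 : 0 < k by rewrite divr_gt0// ltr_wpDl.
have hk : \forall s \near within [set s | t0 <= s] (nbhs t), `|t - s| <= k.
  apply: cvg_within; apply/nbhs_ballP; exists k => //= s; rewrite /ball/=.
  exact: ltW.
near=> s; rewrite distrC.
have h1 : `|p s - p t| <= C * `|s - t| by near: s.
have h2 : `|t - s| <= k by near: s.
apply: le_trans h1 _; rewrite distrC.
apply: (@le_trans _ _ (`|C| * k)).
  by rewrite (le_trans (ler_wpM2r (normr_ge0 _) (ler_norm C)))// ler_wpM2l.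
rewrite /k mulrCA ler_piMr ?(ltW e0)// ler_pdivrMr ?ltr_wpDl//.
by rewrite mul1r lerDl.
Unshelve. all: by end_near. Qed.

Lemma has_deriv_from_cont (t0 : R) p t l : has_deriv_from t0 p t l -> cont_from t0 p t.
Proof.
move=> /cvgrPdist_le /(_ 1 ltr01) h.
apply: (@lipschitz_cont_from _ (`|l| + 1)).
move: h; rewrite /within /dnbhs /=; apply: (@filterS _ (nbhs t)) => s /= h ts.
have [->|st] := eqVneq s t; first by rewrite !subrr normr0 mulr0.
have h' := h st ts.
have -> : p s - p t = (p s - p t) / (s - t) * (s - t) by rewrite divfK// subr_eq0.
rewrite normrM.
rewrite ler_wpM2r//.
rewrite -(subKr l (_ / _)) (le_trans (ler_normB _ _))// lerD2l.
exact: h'.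
Qed.

Lemma cont_from_within (t0 t' : R) p : (forall t, t0 <= t <= t' -> cont_from t0 p t) ->
  {within `[t0, t'], continuous p}.
Proof.
move=> h; apply/subspace_continuousP => t; rewrite /= in_itv/= => /h; rewrite /cont_from.
apply: cvg_trans; apply: cvg_app => A; rewrite /within/=; apply: (@filterS _ (nbhs t)) => s hs.
by rewrite in_itv/= => /andP[? _]; exact: hs.
Qed.

Section Filippov.
Variables (t0 : R) (T : \bar R) (phi s Z : R -> R) (b : R).
Local Notation D := [set t | t0 <= t /\ (t%:E < T)%E].
Hypothesis phic : forall t, t0 <= t -> (t%:E < T)%E -> cont_from t0 phi t.
Hypothesis sm : measurable_fun D s.
Hypothesis s1 : forall t, t0 <= t -> (t%:E < T)%E -> `|s t| <= 1.
Hypothesis b0 : 0 <= b.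
Hypothesis ZE : forall t, t0 <= t -> (t%:E < T)%E ->
  Z t = Z t0 + \int[mu]_(r in `[t0, t]) (phi r + b * s r).

Lemma filippov_le (t t' lo hi : R) : t0 <= t -> t < t' -> (t'%:E < T)%E ->
  (forall r, t < r <= t' -> lo <= phi r + b * s r <= hi) ->
  lo * (t' - t) <= Z t' - Z t <= hi * (t' - t).
Proof.
move=> t0t tt' tT h.
have t0t' : t0 <= t' by lra.
have T' r : r <= t' -> (r%:E < T)%E by move=> rt; apply: le_lt_trans tT; rewrite lee_fin.
have tT' : (t%:E < T)%E by apply: T'; exact: ltW.
rewrite (ZE t0t' tT) (ZE t0t tT') opprD addrACA subrr add0r.
apply: Rintegral_increment => //.
- by apply: cont_from_within => r /andP[r0 r1]; apply: phic => //; exact: T'.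
- apply: measurable_funS sm.
    case: (T) => [T1| |].
    + rewrite (_ : [set _ | _] = `[t0, T1[%classic); first exact: measurable_itv.
      by apply/seteqP; split => r /=; rewrite in_itv/= lte_fin => /andP.
    + rewrite (_ : [set _ | _] = `[t0, +oo[%classic); first exact: measurable_itv.
      by apply/seteqP; split => r /=; rewrite in_itv/= andbT ltry => // -[].
    + rewrite (_ : [set _ | _] = set0); first exact: measurable0.
      by apply/seteqP; split => r //= [].
  by move=> r /=; rewrite in_itv/= => /andP[r0 r1]; split => //; exact: T'.
- by move=> r /andP[r0 r1]; apply: s1 => //; exact: T'.
Qed.

Lemma near_lt_ereal (t : R) : (t%:E < T)%E -> \forall u \near t, (u%:E < T)%E.
Proof.
move: T => [T'| |] //.
- rewrite lte_fin => tT; near=> u; rewrite lte_fin; near: u.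
  exact: lt_nbhsl.
- by move=> _; near=> u; rewrite ltry.
Unshelve. all: by end_near. Qed.

(** One estimate for two uses: [lo = -1] and [hi = 1] give a rate valid at every time, and [lo = hi]
    gives the right derivative where the selection is constant just after [t]. *)
Lemma filippov_dini (t lo hi e : R) : t0 <= t -> (t%:E < T)%E -> 0 < e ->
  (\forall r \near t^'+, lo <= s r <= hi) ->
  \forall u \near t^'+,
    (phi t + b * lo - e) * (u - t) <= Z u - Z t <= (phi t + b * hi + e) * (u - t).
Proof.
move=> t0t tT e0 hs.
have /cvgrPdist_le/(_ _ e0) hphi := cont_from_at_right t0t (phic t0t tT).
have hT : \forall u \near t^'+, (u%:E < T)%E.
  by apply: cvg_within; exact: near_lt_ereal.
have : \forall r \near t^'+, [/\ lo <= s r <= hi, `|phi t - phi r| <= e & (r%:E < T)%E].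
  near=> r; split; near: r; [exact: hs|exact: hphi|exact: hT].
move=> [d /= d0 hd]; near=> u.
have tu : t < u by near: u; exact: nbhs_right_gt.
have ud : u - t < d by near: u; exact: nbhs_right_ltDr.
have hr r : t < r <= u -> [/\ lo <= s r <= hi, `|phi t - phi r| <= e & (r%:E < T)%E].
  move=> /andP[tr ru]; apply: hd => //=.
  by rewrite ler0_norm ?subr_le0 ?ltW//; lra.
apply: filippov_le => //.
  have : t < u <= u by rewrite tu lexx.
  by move=> /hr[].
move=> r /hr[/andP[l1 l2]]; rewrite ler_norml => /andP[h1 h2] _.
have := ler_wpM2l b0 l1; have := ler_wpM2l b0 l2; lra.
Unshelve. all: by end_near. Qed.

Lemma filippov_rate (t e : R) : t0 <= t -> (t%:E < T)%E -> 0 < e ->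
  \forall u \near t^'+, `|Z u - Z t - phi t * (u - t)| <= (b + e) * (u - t).
Proof.
move=> t0t tT e0.
have h : \forall r \near t^'+, -1 <= s r <= 1.
  near=> r; rewrite -ler_norml; apply: s1.
    by apply: ltW; apply: le_lt_trans t0t _; near: r; exact: nbhs_right_gt.
  by near: r; apply: cvg_within; exact: near_lt_ereal.
apply: filterS (filippov_dini t0t tT e0 h) => u.
rewrite ler_norml => /andP[]; lra.
Unshelve. all: by end_near. Qed.

Lemma filippov_rderiv (t v : R) : t0 <= t -> (t%:E < T)%E ->
  (\forall r \near t^'+, s r = v) -> rderiv Z t (phi t + b * v).
Proof.
move=> t0t tT hs; apply/rderivP => e e0.
have h : \forall r \near t^'+, v <= s r <= v by apply: filterS hs => r ->; rewrite lexx.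
apply: filterS (filippov_dini t0t tT e0 h) => u.
rewrite ler_norml => /andP[]; lra.
Qed.

Lemma filippov_cont (t : R) : t0 <= t -> (t%:E < T)%E -> cont_from t0 Z t.
Proof.
move=> t0t tT; pose C := `|phi t| + 1 + b.
have /cvgrPdist_le/(_ _ ltr01) hphi := phic t0t tT.
have hT : \forall u \near within [set u | t0 <= u] (nbhs t), (u%:E < T)%E.
  by apply: cvg_within; exact: near_lt_ereal.
have : \forall r \near within [set u | t0 <= u] (nbhs t),
    `|phi t - phi r| <= 1 /\ (r%:E < T)%E.
  near=> r; split; near: r; [exact: hphi|exact: hT].
move=> [d /= d0 hd].
have hr r : t0 <= r -> `|t - r| < d -> - C <= phi r + b * s r <= C.
  move=> r0 rd; have [h1 rT] := hd r rd r0.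
  rewrite -ler_norml (le_trans (ler_normD _ _))// lerD//.
    by rewrite -(subKr (phi t) (phi r)) (le_trans (ler_normB _ _))// lerD2l.
  by rewrite normrM (ger0_norm b0) ler_piMr// s1.
apply: (@lipschitz_cont_from _ C); exists d => //= u ud u0.
have [h1 uT] := hd u ud u0.
case: (ltgtP u t) => [ut|tu|->]; last by rewrite !subrr normr0 mulr0.
- have : - C * (t - u) <= Z t - Z u <= C * (t - u).
    apply: filippov_le => // r /andP[r1 r2]; apply: hr; first lra.
    by apply: le_lt_trans ud; rewrite !ger0_norm; lra.
  by rewrite mulNr -ler_norml distrC (distrC u) (@ger0_norm _ (t - u))// subr_ge0 ltW.
- have : - C * (u - t) <= Z u - Z t <= C * (u - t).
    apply: filippov_le => // r /andP[r1 r2]; apply: hr; first lra.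
    by apply: le_lt_trans ud; rewrite !ler0_norm; lra.
  by rewrite mulNr -ler_norml (@ger0_norm _ (u - t))// subr_ge0 ltW.
Unshelve. all: by end_near. Qed.

End Filippov.
End Bridge.

(** * Algebraic estimates *)

Section Ineq.
Context {R : realType}.

Lemma sum_cst (n : nat) (r : R) : \sum_(i < n) r = n%:R * r.
Proof. by rewrite sumr_const card_ord mulr_natl. Qed.

Lemma young (x y k : R) : 0 < k -> x * y <= k * x ^+ 2 + y ^+ 2 / (4 * k).
Proof.
move=> k0; rewrite -subr_ge0.
have -> : k * x ^+ 2 + y ^+ 2 / (4 * k) - x * y = (2 * k * x - y) ^+ 2 / (4 * k).
  by field; rewrite gt_eqF.
by rewrite divr_ge0 ?sqr_ge0// mulr_ge0// ltW.
Qed.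

Context {N : nat}.
Variables (m l P abar th lam r : R) (a : 'M[R]_N) (thb : 'I_N -> 'I_N -> R).
Variables (e phi ka ze : 'I_N -> R) (et : 'I_N -> 'I_N -> R).
Hypotheses (m0 : 0 < m) (l0 : 0 <= l) (P0 : 0 <= P) (th0 : 0 < th).
Hypothesis thb0 : forall i j, 0 < thb i j.
Hypothesis thbP : forall i j, (thb i j)^-1 <= P.
Hypothesis aP : forall i j, 0 <= a i j <= abar.
Hypothesis lamP : forall j v, lam * \sum_i v i ^+ 2 <= pinned_form a j v.
Hypothesis r0 : 0 <= r.
Hypothesis er : forall i, `|e i| <= r.
Hypothesis etr : forall i j, `|et i j| <= r.
Hypothesis ka0 : forall i, 0 <= ka i.
Hypothesis mono : m * \sum_i e i ^+ 2 - l * \sum_i `|e i| * \sum_j `|et i j| <=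
  \sum_i e i * phi i.
Hypothesis lip : forall j, `|phi j| <= l * \sum_k (`|et j k| + `|e k|).

Local Notation n := (N%:R : R).
Local Notation de j := (- phi j + ka j * ze j).
Local Notation E := (\sum_i e i ^+ 2).
Local Notation H := (\sum_i \sum_j et i j ^+ 2).
Local Notation W := (\sum_j ka j * `|ze j|).

(** A quarter of [m] pays for the disagreement here, and another quarter in [drift_bound]; [m / 2]
    remains in [slow_decay]. Young's parameter [m / (4 * n)] spreads this quarter over the [n] pairs
    that share [e i]. *)
Lemma leader_decay :
  \sum_i e i * de i <= - (3 / 4 * m) * E + l ^+ 2 * n / m * H + r * W.
Proof.
have h1 : \sum_i e i * de i = - (\sum_i e i * phi i) + \sum_i e i * (ka i * ze i).
  by rewrite -sumrN -big_split; apply: eq_bigr => i _ /=; ring.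
have h2 : \sum_i e i * (ka i * ze i) <= r * W.
  rewrite mulr_sumr; apply: ler_sum => i _.
  rewrite (le_trans (ler_norm _))// !normrM (ger0_norm (ka0 i)).
  by rewrite ler_wpM2r// mulr_ge0.
have h3 : l * (\sum_i `|e i| * \sum_j `|et i j|) <= m / 4 * E + l ^+ 2 * n / m * H.
  have [n0|n0] := posnP N.
    have z (F : 'I_N -> R) : \sum_i F i = 0.
      by apply: big1 => i; exfalso; case: i; rewrite n0.
    by rewrite !z !mulr0 addr0.
  have n0' : 0 < n by rewrite ltr0n.
  rewrite 3!mulr_sumr -big_split; apply: ler_sum => i _ /=.
  have -> : m / 4 * e i ^+ 2 = \sum_(j < N) (m / (4 * n) * `|e i| ^+ 2).
    by rewrite sum_cst real_normK ?num_real//; field; rewrite gt_eqF.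
  rewrite !mulr_sumr -big_split /=; apply: ler_sum => j _.
  have k0 : 0 < m / (4 * n) by rewrite divr_gt0// mulr_gt0.
  apply: le_trans (le_trans (_ : _ <= `|e i| * (l * `|et i j|)) (young _ _ k0)) _.
    by rewrite le_eqVlt; apply/orP; left; apply/eqP; ring.
  rewrite lerD2l exprMn real_normK ?num_real//.
  by rewrite le_eqVlt; apply/orP; left; apply/eqP; field; rewrite !gt_eqF.
rewrite h1; move: h2 h3 mono.
move: (l ^+ 2 * n / m * H) E (\sum_i `|e i| * \sum_j `|et i j|) (\sum_i e i * phi i)
  (\sum_i e i * (ka i * ze i)) W => x1 x2 x3 x4 x5 x6.
lra.
Qed.

(** Dividing by [thb i j] undoes the individual gains, so that each column [j] yields one pinned
    form. The terms in [ze j] appear because the protocol follows [x], whereas [et] is measured from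
    the observer state. *)
Lemma consensus_decay :
  \sum_i \sum_j et i j * (- (th * thb i j) *
      (\sum_k a i k * (et i j - et k j) + a i j * (et i j - ze j))) / thb i j
  <= - (th * lam) * H + th * abar * r * n * \sum_j `|ze j|.
Proof.
have -> : \sum_i \sum_j et i j * (- (th * thb i j) *
      (\sum_k a i k * (et i j - et k j) + a i j * (et i j - ze j))) / thb i j
  = - th * (\sum_j pinned_form a j (et^~ j)) + th * \sum_i \sum_j a i j * et i j * ze j.
  rewrite [X in - th * X + _]exchange_big /= !mulr_sumr -big_split; apply: eq_bigr => i _ /=.
  rewrite !mulr_sumr -big_split; apply: eq_bigr => j _ /=.
  by field; rewrite gt_eqF.
apply: lerD.
  rewrite !mulNr lerN2 -mulrA ler_wpM2l ?(ltW th0)//.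
  rewrite [X in lam * X]exchange_big mulr_sumr; apply: ler_sum => j _; exact: lamP.
rewrite -[leRHS]mulrA -[leRHS]mulrA -[leRHS]mulrA ler_wpM2l ?(ltW th0)// !mulrA.
have -> : abar * r * n * (\sum_j `|ze j|) = \sum_(i < N) \sum_j abar * r * `|ze j|.
  by rewrite sum_cst -mulr_sumr; ring.
apply: ler_sum => i _; apply: ler_sum => j _.
have /andP[a0 a1] := aP i j.
rewrite (le_trans (ler_norm _))// !normrM (ger0_norm a0) ler_wpM2r//.
by rewrite ler_pM.
Qed.

(** The cost of a moving target: [et] is relative to the observer state, whose velocity has the
    components [- phi j + ka j * ze j]. *)
Lemma drift_bound :
  \sum_i \sum_j et i j * (- de j) / thb i j
  <= m / 4 * E + (P * l * n + P ^+ 2 * l ^+ 2 * n ^+ 3 / m) * H + P * r * n * W.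
Proof.
have [nz|nz] := posnP N.
  have z (F : 'I_N -> R) : \sum_i F i = 0.
    by apply: big1 => i; exfalso; case: i; rewrite nz.
  by rewrite !z !mulr0 !addr0.
have n0 : 0 < n by rewrite ltr0n.
apply: (@le_trans _ _ (\sum_i \sum_j (P * `|et i j| * `|phi j| + P * r * (ka j * `|ze j|)))).
  apply: ler_sum => i _; apply: ler_sum => j _.
  rewrite (le_trans (ler_norm _))// !normrM normrN normfV (gtr0_norm (thb0 i j)).
  rewrite mulrAC (mulrC _ (thb i j)^-1).
  have h1 : `|- phi j + ka j * ze j| <= `|phi j| + ka j * `|ze j|.
    by rewrite (le_trans (ler_normD _ _))// normrN normrM (ger0_norm (ka0 j)).
  apply: (@le_trans _ _ (P * `|et i j| * (`|phi j| + ka j * `|ze j|))).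
    apply: ler_pM => //; first by rewrite mulr_ge0// invr_ge0 ltW.
    by rewrite ler_wpM2r.
  rewrite mulrDr lerD2l ler_wpM2r ?mulr_ge0// ler_wpM2l//.
have -> : \sum_i \sum_j (P * `|et i j| * `|phi j| + P * r * (ka j * `|ze j|)) =
    \sum_i \sum_j P * `|et i j| * `|phi j| + P * r * n * W.
  have -> : P * r * n * W = \sum_(i < N) \sum_j P * r * (ka j * `|ze j|).
    by rewrite sum_cst -mulr_sumr; ring.
  by rewrite -big_split; apply: eq_bigr => i _; rewrite -big_split.
rewrite lerD2r.
(* Each [e k] now meets [n ^+ 2] pairs [(i, j)], hence the square of [n]. *)
have k0 : 0 < m / (4 * n ^+ 2) by rewrite divr_gt0// mulr_gt0// exprn_gt0.
pose B i j k := P * l / 2 * (et i j ^+ 2 + et j k ^+ 2)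
  + (m / (4 * n ^+ 2) * e k ^+ 2 + P ^+ 2 * l ^+ 2 * n ^+ 2 / m * et i j ^+ 2).
apply: (@le_trans _ _ (\sum_i \sum_j \sum_k B i j k)).
  apply: ler_sum => i _; apply: ler_sum => j _.
  apply: (@le_trans _ _ (P * `|et i j| * (l * \sum_k (`|et j k| + `|e k|)))).
    by rewrite ler_wpM2l// mulr_ge0.
  rewrite !mulr_sumr; apply: ler_sum => k _.
  rewrite /B -(real_normK (num_real (et i j))) -(real_normK (num_real (et j k))).
  rewrite -(real_normK (num_real (e k))).
  move: (normr_ge0 (et i j)) (normr_ge0 (et j k)) (normr_ge0 (e k)).
  move: `|et i j| `|et j k| `|e k| => x y z x0 y0 z0.
  have h1 : P * l * (x * y) <= P * l * ((x ^+ 2 + y ^+ 2) / 2).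
    rewrite ler_wpM2l ?mulr_ge0//.
    have : 0 <= (x - y) ^+ 2 by rewrite sqr_ge0.
    lra.
  have h2 := young z (P * l * x) k0.
  have h3 : (P * l * x) ^+ 2 / (4 * (m / (4 * n ^+ 2))) =
      P ^+ 2 * l ^+ 2 * n ^+ 2 / m * x ^+ 2.
    by field; rewrite !gt_eqF.
  lra.
rewrite /B.
have -> : \sum_i \sum_j \sum_k (P * l / 2 * (et i j ^+ 2 + et j k ^+ 2)
  + (m / (4 * n ^+ 2) * e k ^+ 2 + P ^+ 2 * l ^+ 2 * n ^+ 2 / m * et i j ^+ 2)) =
  (P * l / 2 + P ^+ 2 * l ^+ 2 * n ^+ 2 / m) * (\sum_i \sum_j \sum_(k < N) et i j ^+ 2)
  + P * l / 2 * (\sum_(i < N) H) + m / (4 * n ^+ 2) * (\sum_(i < N) \sum_(j < N) E).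
  rewrite !mulr_sumr -!big_split; apply: eq_bigr => i _ /=.
  rewrite !mulr_sumr -!big_split; apply: eq_bigr => j _ /=.
  rewrite !mulr_sumr -!big_split; apply: eq_bigr => k _ /=; ring.
have -> : \sum_i \sum_j \sum_(k < N) et i j ^+ 2 = n * H.
  rewrite mulr_sumr; apply: eq_bigr => i _; rewrite mulr_sumr.
  by apply: eq_bigr => j _; rewrite sum_cst.
rewrite !sum_cst le_eqVlt; apply/orP; left; apply/eqP.
by field; rewrite !gt_eqF.
Qed.

(** The lower bound on [th * lam] collects the coefficients of the squared [et] from the three
    preceding estimates and adds [m / 2], so that both sums of squares decay at the same rate. *)
Lemma slow_decay :
  l ^+ 2 * n / m + P * l * n + P ^+ 2 * l ^+ 2 * n ^+ 3 / m + m / 2 <= th * lam ->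
  \sum_i e i * de i + \sum_i \sum_j et i j * (- (th * thb i j) *
      (\sum_k a i k * (et i j - et k j) + a i j * (et i j - ze j)) - de j) / thb i j
  <= - (m / 2) * (E + H) + r * \sum_j ((1 + P * n) * ka j + th * abar * n) * `|ze j|.
Proof.
move=> hth.
have -> : \sum_i \sum_j et i j * (- (th * thb i j) *
      (\sum_k a i k * (et i j - et k j) + a i j * (et i j - ze j)) - de j) / thb i j =
  \sum_i \sum_j et i j * (- (th * thb i j) *
      (\sum_k a i k * (et i j - et k j) + a i j * (et i j - ze j))) / thb i j +
  \sum_i \sum_j et i j * (- de j) / thb i j.
  rewrite -big_split; apply: eq_bigr => i _ /=.
  by rewrite -big_split; apply: eq_bigr => j _ /=; rewrite -mulrDl -mulrDr.
have h1 := leader_decay; have h2 := consensus_decay; have h3 := drift_bound.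
have H0 : 0 <= H by apply: sumr_ge0 => i _; apply: sumr_ge0 => j _; rewrite sqr_ge0.
have h4 := ler_wpM2r H0 hth.
have -> : r * (\sum_j ((1 + P * n) * ka j + th * abar * n) * `|ze j|) =
  r * W + P * r * n * W + th * abar * r * n * \sum_j `|ze j|.
  rewrite !mulr_sumr -!big_split; apply: eq_bigr => j _ /=; ring.
lra.
Qed.

End Ineq.

(** * Norms, Nash stationarity, bounds on boxes *)

Section Prelim.
Context {R : realType}.

Lemma enorm_sqr k (v : 'rV[R]_k) : enorm v ^+ 2 = \sum_i v 0 i ^+ 2.
Proof. by rewrite sqr_sqrtr// sumr_ge0// => i _; rewrite sqr_ge0. Qed.

Lemma enorm_ge0 k (v : 'rV[R]_k) : 0 <= enorm v.
Proof. exact: sqrtr_ge0. Qed.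

Lemma entry_le_enorm k (v : 'rV[R]_k) i : `|v 0 i| <= enorm v.
Proof.
rewrite -(@ler_pXn2r _ 2)// ?nnegrE ?enorm_ge0// enorm_sqr real_normK ?num_real//.
by apply: (ler_term (F := fun j => v 0 j ^+ 2)) => j; rewrite sqr_ge0.
Qed.

Lemma enorm_sqr_le k (v : 'rV[R]_k) M : (forall i, v 0 i ^+ 2 <= M) -> enorm v ^+ 2 <= k%:R * M.
Proof. by move=> h; rewrite enorm_sqr -sum_cst; apply: ler_sum => i _. Qed.

Section Error.
Context {N : nat}.
Variables (g : 'I_N -> 'rV[R]_N -> R) (d : 'I_N -> R -> R) (ks : 'I_N -> R).
Variables (x : R -> 'rV[R]_N) (y : R -> 'M[R]_N) (xh zh : R -> 'rV[R]_N).
Variables (xs : 'rV[R]_N) (t : R).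
Local Notation err := (error g d ks x y xh zh xs t).

Lemma entry_le_error : [/\ forall i, `|zeta1 x xh t 0 i| <= enorm err,
  forall i, `|zeta2 g d x zh t 0 i| <= enorm err,
  forall i, `|xi x xs t 0 i| <= enorm err,
  forall i j, `|eta x y t i j| <= enorm err &
  forall i, `|gamma g d ks x xh zh t 0 i| <= enorm err].
Proof.
split=> [i|i|i|i j|i].
- by have := entry_le_enorm err (lshift _ i); rewrite /error row_mxEl.
- by have := entry_le_enorm err (rshift _ (lshift _ i)); rewrite /error row_mxEr row_mxEl.
- have := entry_le_enorm err (rshift _ (rshift _ (lshift _ i))).
  by rewrite /error !row_mxEr row_mxEl.
- have := entry_le_enorm err (rshift _ (rshift _ (rshift _ (lshift _ (mxvec_index i j))))).
  by rewrite /error !row_mxEr row_mxEl mxvecE.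
- have := entry_le_enorm err (rshift _ (rshift _ (rshift _ (rshift _ i)))).
  by rewrite /error !row_mxEr.
Qed.

Lemma error_sqr_le M :
  (forall i, zeta1 x xh t 0 i ^+ 2 <= M) -> (forall i, zeta2 g d x zh t 0 i ^+ 2 <= M) ->
  (forall i, xi x xs t 0 i ^+ 2 <= M) -> (forall i j, eta x y t i j ^+ 2 <= M) ->
  (forall i, gamma g d ks x xh zh t 0 i ^+ 2 <= M) ->
  enorm err ^+ 2 <= (N + (N + (N + (N * N + N))))%:R * M.
Proof.
move=> h1 h2 h3 h4 h5; apply: enorm_sqr_le => i; rewrite /error.
case: (split_ordP i) => j ->; rewrite ?row_mxEl ?row_mxEr//.
case: (split_ordP j) => k ->; rewrite ?row_mxEl ?row_mxEr//.
case: (split_ordP k) => l ->; rewrite ?row_mxEl ?row_mxEr//.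
case: (split_ordP l) => u ->; rewrite ?row_mxEl ?row_mxEr//.
by case/mxvec_indexP: u => p q; rewrite mxvecE.
Qed.

End Error.

Lemma nash_stationary (N : nat) (f : 'I_N -> 'rV[R]_N -> R) xs i :
  C1 (f i) -> is_nash f xs -> partial i (f i) xs = 0.
Proof.
move=> fC hn.
have hd (r : R) := is_derive_line xs i r fC.
have h0 : (0 : R) \in `]-1, 1[ by rewrite in_itv/= oppr_lt0 ltr01.
have lt11 : (-1 : R) <= 1 by lra.
have := derive1_at_min (f := fun r : R => f i (xs + r *: 'e_i)) lt11 _ h0 _.
case.
- by move=> r _; case: (hd r).
- move=> r _; rewrite scale0r addr0; apply: le_trans (hn i (xs 0 i + r)) _.
  rewrite le_eqVlt; apply/orP; left; apply/eqP; congr f.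
  apply/rowP => j; rewrite !mxE eqxx/=.
  by case: eqVneq => [->|_]; rewrite ?mulr1 ?mulr0 ?addr0.
move=> _ h1; have [_ h2] := hd 0.
move: h2; rewrite h1 scale0r addr0 => h2; exact: esym.
Qed.

Lemma box_bound (N : nat) (I : finType) (h : I -> 'rV[R]_N -> R) (r : R) :
  (forall i, continuous (h i)) ->
  exists B : R, 0 <= B /\ forall i (x : 'rV[R]_N), (forall k, `|x 0 k| <= r) -> `|h i x| <= B.
Proof.
move=> hc; have /choice[C hC] := fun i => continuous_bounded_box r (hc i).
exists (\sum_i `|C i|); split; first by apply: sumr_ge0.
move=> i x hx; apply: le_trans (hC i x hx) _; apply: le_trans (ler_norm _) _.
exact: (ler_term (F := fun j => `|C j|)).
Qed.

Lemma strongly_monotoneP (N : nat) (F : 'rV[R]_N -> 'rV[R]_N) : strongly_monotone F ->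
  exists m : R, 0 < m /\ forall u v : 'rV[R]_N, m * \sum_i (u 0 i - v 0 i) ^+ 2 <=
    \sum_i (u 0 i - v 0 i) * (F u 0 i - F v 0 i).
Proof.
move=> [m [m0 h]]; exists m; split => // u v; have := h u v; rewrite enorm_sqr mxE.
have -> : \sum_i (u - v) 0 i ^+ 2 = \sum_i (u 0 i - v 0 i) ^+ 2.
  by apply: eq_bigr => i _; rewrite !mxE.
move=> /le_trans; apply; apply: ler_sum => i _; by rewrite !mxE.
Qed.

End Prelim.

(** * The closed loop around the observer state *)

Section Coordinates.
Unset Implicit Arguments.
Context {R : realType} {N : nat}.
Variables (t0 : R) (f g : 'I_N -> 'rV[R]_N -> R) (d d' d'' : 'I_N -> R -> R).
Variables (a : 'M[R]_N) (th : 'I_N -> 'I_N -> R) (ks c b : 'I_N -> R).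
Variables (x : R -> 'rV[R]_N) (y : R -> 'M[R]_N) (xh zh : R -> 'rV[R]_N).
Variables (xs : 'rV[R]_N) (T : \bar R).
Implicit Types (i j k : 'I_N) (t : R).

Definition track_err i t := xh t 0 i - xs 0 i.
Definition cons_err i j t := y t i j - xh t 0 j.
Definition obs_err i t := x t 0 i - xh t 0 i.
Definition pgrad i t := partial i (f i) (row i (y t)).
Definition gslope i j t := partial j (g i) (xh t).
(* [gamma] minus [g (x) - g (xh)]: unlike [gamma], it is not driven by the
   observer oscillations of the other players. *)
Definition filtered i t := d i t + g i (xh t) - zh t 0 i - ks i * obs_err i t.
Definition fast_gap i t := g i (x t) - g i (xh t).
(* Along solutions, the derivative of [filtered i] is
   [- ks i * filtered i - ks i * fast_gap i + slow_drift i + obs_drift i - b i * sgn (obs_err i)]; only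
   [slow_drift i] is not bounded by the observation errors, but it is Lipschitz. *)
Definition slow_drift i t := d' i t - \sum_j gslope i j t * pgrad j t.
Definition obs_drift i t := \sum_j gslope i j t * ((ks j + c j) * obs_err j t).

(** The velocity of [xh]: the [zh] of the control law is cancelled by the one in the observer
    equation. *)
Definition track_vel i t := - pgrad i t + (ks i + c i) * obs_err i t.
(** The velocity of [y i j], not of [cons_err i j], in error coordinates: [cons_err i j - obs_err j]
    is [y i j - x j]. *)
Definition cons_vel i j t := - th i j *
  (\sum_k a i k * (cons_err i j t - cons_err k j t) + a i j * (cons_err i j t - obs_err j t)).
(** Apart from the disturbance, only the velocities of [xh] and [y] enter; they contain neither [zh]
    nor [b], hence a bound on the region that is uniform in [b]. *)
Definition slow_drift_vel i t := d'' i t - \sum_j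
  ((\sum_k partial k (partial j (g i)) (xh t) * track_vel k t) * pgrad j t
   + gslope i j t * (\sum_k partial k (partial j (f j)) (row j (y t)) * cons_vel j k t)).

Hypothesis sol : closed_loop_solution t0 f g d a th ks c b x y xh zh T.
Hypothesis fC : forall i, C2 (f i).
Hypothesis gC : forall i, C2 (g i).
Hypothesis dd : forall i t, t0 <= t -> has_deriv_from t0 (d i) t (d' i t).
Hypothesis dd' : forall i t, t0 <= t -> has_deriv_from t0 (d' i) t (d'' i t).
Hypothesis b0 : forall i, 0 <= b i.

Lemma cont_fromD t p q : cont_from t0 p t -> cont_from t0 q t -> cont_from t0 (fun s => p s + q s) t.
Proof. exact: cvgD. Qed.
Lemma cont_fromB t p q : cont_from t0 p t -> cont_from t0 q t -> cont_from t0 (fun s => p s - q s) t.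
Proof. exact: cvgB. Qed.
Lemma cont_fromM t p q : cont_from t0 p t -> cont_from t0 q t -> cont_from t0 (fun s => p s * q s) t.
Proof. exact: cvgM. Qed.
Lemma cont_from_cst t r : cont_from t0 (fun=> r) t.
Proof. exact: cvg_cst. Qed.
Lemma cont_from_sum t (I : finType) (p : I -> R -> R) : (forall l, cont_from t0 (p l) t) ->
  cont_from t0 (fun s => \sum_l p l s) t.
Proof. by move=> h; apply: cvg_sumr => l; exact: h. Qed.

Section AtTime.
Variable t : R.
Hypotheses (t0t : t0 <= t) (tT : (t%:E < T)%E).

Lemma xh_deriv i : has_deriv_from t0 (fun s => xh s 0 i) t (track_vel i t).
Proof.
have [_ _ h _] := sol; have := h t i t0t tT.
congr has_deriv_from; rewrite /control /track_vel /pgrad /obs_err; ring.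
Qed.

Lemma x_deriv i : has_deriv_from t0 (fun s => x s 0 i) t
  (- pgrad i t + filtered i t + ks i * obs_err i t + fast_gap i t).
Proof.
have [h _ _ _] := sol; have := h t i t0t tT.
congr has_deriv_from; rewrite /control /filtered /fast_gap /pgrad; ring.
Qed.

Lemma y_deriv i j : has_deriv_from t0 (fun s => y s i j) t (cons_vel i j t).
Proof.
have [_ h _ _] := sol; have := h t i j t0t tT.
congr has_deriv_from; rewrite /cons_vel; congr (_ * (_ + _ * _)).
  by apply: eq_bigr => k _; rewrite /cons_err; ring.
by rewrite /cons_err /obs_err; ring.
Qed.

Lemma lead_rderiv i : rderiv (track_err i) t (track_vel i t).
Proof.
apply: (rderiv_eq (rderivB (has_deriv_from_rderiv t0t (xh_deriv i)) (rderiv_cst (xs 0 i) t))).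
exact: subr0.
Qed.

Lemma disa_rderiv i j : rderiv (cons_err i j) t (cons_vel i j t - track_vel j t).
Proof.
exact: rderivB (has_deriv_from_rderiv t0t (y_deriv i j)) (has_deriv_from_rderiv t0t (xh_deriv j)).
Qed.

Lemma obs_rderiv i : rderiv (obs_err i) t (filtered i t + fast_gap i t - c i * obs_err i t).
Proof.
apply: (rderiv_eq (rderivB (has_deriv_from_rderiv t0t (x_deriv i))
  (has_deriv_from_rderiv t0t (xh_deriv i)))).
rewrite /track_vel; ring.
Qed.

Lemma pgrad_rderiv j : rderiv (pgrad j) t
  (\sum_k partial k (partial j (f j)) (row j (y t)) * cons_vel j k t).
Proof.
apply: (@C1_rderiv _ _ (partial j (f j)) (fun s => row j (y s))); first exact: (fC j).2.
move=> k; apply: eq_rderiv (has_deriv_from_rderiv t0t (y_deriv j k)).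
by move=> s; rewrite mxE.
Qed.

Lemma slope_rderiv i j : rderiv (gslope i j) t
  (\sum_k partial k (partial j (g i)) (xh t) * track_vel k t).
Proof.
apply: (@C1_rderiv _ _ (partial j (g i)) xh); first exact: (gC i).2.
by move=> k; exact: has_deriv_from_rderiv t0t (xh_deriv k).
Qed.

Lemma slow_rderiv i : rderiv (slow_drift i) t (slow_drift_vel i t).
Proof.
apply: rderivB; first exact: has_deriv_from_rderiv t0t (dd' i t t0t).
apply: rderiv_sum => j; apply: rderivM; [exact: slope_rderiv|exact: pgrad_rderiv].
Qed.

Lemma obs_cont i : cont_from t0 (obs_err i) t.
Proof.
by apply: cont_fromB; [exact: has_deriv_from_cont (x_deriv i)|exact: has_deriv_from_cont (xh_deriv i)].
Qed.

Lemma lead_cont i : cont_from t0 (track_err i) t.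
Proof. by apply: cont_fromB; [exact: has_deriv_from_cont (xh_deriv i)|exact: cont_from_cst]. Qed.

Lemma disa_cont i j : cont_from t0 (cons_err i j) t.
Proof.
by apply: cont_fromB; [exact: has_deriv_from_cont (y_deriv i j)|exact: has_deriv_from_cont (xh_deriv j)].
Qed.

Lemma slow_cont i : cont_from t0 (slow_drift i) t.
Proof.
apply: cont_fromB; first exact: has_deriv_from_cont (dd' i t t0t).
apply: cont_from_sum => j; apply: cont_fromM.
  apply: C1_cvg; first exact: (gC i).2.
  by move=> k; exact: has_deriv_from_cont (xh_deriv k).
apply: C1_cvg; first exact: (fC j).2.
by move=> k; rewrite mxE; under eq_fun do rewrite mxE; exact: has_deriv_from_cont (y_deriv j k).
Qed.

End AtTime.

Lemma zh_selection i : exists s : R -> R,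
  [/\ measurable_fun [set t | t0 <= t /\ (t%:E < T)%E] s,
      forall t, t0 <= t -> (t%:E < T)%E -> `|s t| <= 1,
      forall t, t0 <= t -> (t%:E < T)%E -> obs_err i t != 0 -> s t = Num.sg (obs_err i t) &
      forall t, t0 <= t -> (t%:E < T)%E -> zh t 0 i = zh t0 0 i
        + \int[lebesgue_measure]_(r in `[t0, t]) (ks i * c i * obs_err i r + b i * s r)].
Proof.
have [_ _ _ [s [ms hs hz]]] := sol; exists (s i); split => //.
- by move=> t t0t tT; rewrite ler_norml; have [] := hs t i t0t tT.
- by move=> t t0t tT; have [_] := hs t i t0t tT.
- by move=> t t0t tT; exact: hz.
Qed.

Section AtTime2.
Variable t : R.
Hypotheses (t0t : t0 <= t) (tT : (t%:E < T)%E).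
Local Notation A i := (- ks i * filtered i t - ks i * fast_gap i t + (slow_drift i t + obs_drift i t)).

(** This is [filtered i] without its term in [zh]. The summand [ks i * c i * obs_err i] is cancelled
    by the same one in the integrand of [zh], which explains the product of gains in the
    observer. *)
Lemma smooth_rderiv i : rderiv (fun s => d i s + g i (xh s) - ks i * obs_err i s) t
  (A i + ks i * c i * obs_err i t).
Proof.
have h := rderivB (rderivD (has_deriv_from_rderiv t0t (dd i t t0t))
   (C1_rderiv (gC i).1 (fun k => has_deriv_from_rderiv t0t (xh_deriv t t0t tT k))))
   (rderivZ (k := ks i) (obs_rderiv t t0t tT i)).
apply: (rderiv_eq h).
rewrite /track_vel /slow_drift /obs_drift.
have -> : \sum_j partial j (g i) (xh t) * (- pgrad j t + (ks j + c j) * obs_err j t) =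
   - (\sum_j gslope i j t * pgrad j t) + \sum_j gslope i j t * ((ks j + c j) * obs_err j t).
  by rewrite -sumrN -big_split; apply: eq_bigr => j _ /=; rewrite /gslope; ring.
ring.
Qed.

Lemma obs_scaled_cont i s : t0 <= s -> (s%:E < T)%E ->
  cont_from t0 (fun r => ks i * c i * obs_err i r) s.
Proof. by move=> h1 h2; apply: cont_fromM; [exact: cont_from_cst|exact: obs_cont]. Qed.

Lemma filt_cont i : cont_from t0 (filtered i) t.
Proof.
have [s [ms s1 _ hz]] := zh_selection i.
have zc := filippov_cont (obs_scaled_cont i) ms s1 (b0 i) hz t0t tT.
apply: cont_fromB; last first.
  by apply: cont_fromM; [exact: cont_from_cst|exact: obs_cont].
apply: cont_fromB => //; apply: cont_fromD; first exact: has_deriv_from_cont (dd i t t0t).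
apply: C1_cvg; first exact: (gC i).1.
by move=> k; exact: has_deriv_from_cont (xh_deriv t t0t tT k).
Qed.

Lemma filt_rate i e : 0 < e -> \forall s \near t^'+,
  `|filtered i s - filtered i t - A i * (s - t)| <= (b i + e) * (s - t).
Proof.
move=> e0; have [sg [ms s1 _ hz]] := zh_selection i.
have e2 : 0 < e / 2 by lra.
have h1 := filippov_rate (obs_scaled_cont i) ms s1 (b0 i) hz t0t tT e2.
have /rderivP h2 := smooth_rderiv i.
near=> s.
have : `|zh s 0 i - zh t 0 i - ks i * c i * obs_err i t * (s - t)| <= (b i + e / 2) * (s - t).
  by near: s; exact: h1.
have : `|(d i s + g i (xh s) - ks i * obs_err i s) - (d i t + g i (xh t) - ks i * obs_err i t)
    - (A i + ks i * c i * obs_err i t) * (s - t)| <= e / 2 * (s - t).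
  by near: s; exact: h2.
move=> h3 h4.
rewrite (_ : filtered i s - filtered i t - A i * (s - t) =
 ((d i s + g i (xh s) - ks i * obs_err i s) - (d i t + g i (xh t) - ks i * obs_err i t)
    - (A i + ks i * c i * obs_err i t) * (s - t))
 - (zh s 0 i - zh t 0 i - ks i * c i * obs_err i t * (s - t))); last by rewrite /filtered; ring.
apply: le_trans (ler_normB _ _) _.
rewrite (_ : (b i + e) * (s - t) = e / 2 * (s - t) + (b i + e / 2) * (s - t)); last by field.
exact: lerD.
Unshelve. all: by end_near. Qed.

(** Off the zeros of [obs_err i] the selection must be the signum, so the rate of [filt_rate]
    sharpens to a derivative. *)
Lemma filt_rderiv i v : v != 0 ->
  (\forall s \near t^'+, Num.sg (obs_err i s) = v) -> rderiv (filtered i) t (A i - b i * v).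
Proof.
move=> v0 hv; have [sg [ms s1 hsg hz]] := zh_selection i.
have h : \forall s \near t^'+, sg s = v.
  near=> s.
  have sv : Num.sg (obs_err i s) = v by near: s.
  rewrite hsg//.
  - by apply: ltW; apply: le_lt_trans t0t _; near: s; exact: nbhs_right_gt.
  - by near: s; apply: cvg_within; exact: near_lt_ereal.
  - by rewrite -sgr_eq0 sv.
have h1 := filippov_rderiv (obs_scaled_cont i) ms s1 (b0 i) hz t0t tT h.
apply: eq_rderiv (rderiv_eq (rderivB (smooth_rderiv i) h1) _).
  by move=> s; rewrite /filtered; ring.
ring.
Unshelve. all: by end_near. Qed.

Lemma energy_dini i H1 : `|slow_drift_vel i t| < H1 ->
  dini_le (fun s => filtered i s ^+ 2 / 2 + b i * `|obs_err i s| - obs_err i s * slow_drift i s) t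
    (filtered i t * A i + b i * `|fast_gap i t| - c i * b i * `|obs_err i t|
     + (- slow_drift i t * (filtered i t + fast_gap i t - c i * obs_err i t) + H1 * `|obs_err i t|)).
Proof.
move=> hH; apply: rise_dini => //.
- exact: obs_rderiv.
- by move=> e e0; exact: filt_rate.
- move=> h; have h' : \forall s \near t^'+, Num.sg (obs_err i s) = 1.
    by apply: filterS h => s /gtr0_sg.
  apply: (rderiv_eq (filt_rderiv i 1 (oner_neq0 _) h')); ring.
- move=> h; have h' : \forall s \near t^'+, Num.sg (obs_err i s) = -1.
    by apply: filterS h => s /ltr0_sg.
  have n0 : -1 != 0 :> R by rewrite oppr_eq0 oner_neq0.
  apply: (rderiv_eq (filt_rderiv i (-1) n0 h')); ring.
have /rderivP := slow_rderiv t t0t tT i.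
(* The strict bound leaves room for the remainder in the first-order expansion of [slow_drift i]. *)
have e0 : 0 < H1 - `|slow_drift_vel i t| by rewrite subr_gt0.
move=> /(_ _ e0) h; near=> s.
have st : 0 < s - t by rewrite subr_gt0; near: s; exact: nbhs_right_gt.
have h1 : `|slow_drift i s - slow_drift i t - slow_drift_vel i t * (s - t)| <= (H1 - `|slow_drift_vel i t|) * (s - t).
  by near: s.
rewrite -(subrK (slow_drift_vel i t * (s - t)) (_ - _)) (le_trans (ler_normD _ _))//.
rewrite normrM (gtr0_norm st); lra.
Unshelve. all: by end_near. Qed.

End AtTime2.
End Coordinates.

Arguments lead_rderiv {R N t0 f g d a th ks c b x y xh zh} xs {T} sol {t} t0t tT i.
Arguments disa_rderiv {R N t0 f g d a th ks c b x y xh zh T} sol {t} t0t tT i j.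
Arguments obs_cont {R N t0 f g d a th ks c b x y xh zh T} sol {t} t0t tT i.
Arguments lead_cont {R N t0 f g d a th ks c b x y xh zh} xs {T} sol {t} t0t tT i.
Arguments disa_cont {R N t0 f g d a th ks c b x y xh zh T} sol {t} t0t tT i j.
Arguments slow_cont {R N t0 f g d d' d'' a th ks c b x y xh zh T} sol fC gC dd' {t} t0t tT i.
Arguments filt_cont {R N t0 f g d d' a th ks c b x y xh zh T} sol gC dd b0 {t} t0t tT i.
Arguments energy_dini {R N t0 f g d d' d'' a th ks c b x y xh zh T} sol fC gC dd dd' b0 {t} t0t tT i H1 _.

(** * Decay of the Lyapunov function *)

(** After multiplication by [b], the only harmful term of order [b] is [b * |de|], at most
    [b * B * Z]. The others are at most a constant times [Z], by [Z ^+ 2 <= X * Z] for the quadratic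
    one, and the lower bound on [b] makes this constant at most [b]. Hence the coefficient [B + 1],
    in which [b] and [c] do not occur. *)
Lemma fast_decay (R : realType) (om de ze h r k c b Z B G H0 H1 X : R) :
  1 <= k -> 0 < b -> 0 <= c -> 0 <= H1 -> 0 <= G -> 0 <= B ->
  `|de| <= B * Z -> k * `|de| + `|r| <= G * Z -> Z <= X -> `|ze| <= Z ->
  `|h| <= H0 -> G ^+ 2 * X / 2 + H0 * B + H0 * c + H1 <= b ->
  b^-1 * (om * (- k * om - k * de + (h + r)) + b * `|de| - c * b * `|ze|
     + (- h * (om + de - c * ze) + H1 * `|ze|))
  <= - (k / 2 * (b^-1 * om ^+ 2)) - c * `|ze| + (B + 1) * Z.
Proof.
move=> k1 b0 c0 H10 G0 B0 hde hr ZX zeZ hh hb.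
have Z0 : 0 <= Z by exact: le_trans zeZ.
have H00 : 0 <= H0 by exact: le_trans hh.
rewrite -(ler_pM2l b0) mulrA mulfV ?gt_eqF// mul1r.
rewrite [leRHS](_ : _ = - (k / 2 * om ^+ 2) - b * (c * `|ze|) + b * ((B + 1) * Z)); last first.
  by field; rewrite gt_eqF.
(* Half of [k * om ^+ 2] suffices to absorb the product because [1 <= k]. *)
have h1 : om * (- (k * de) + r) <= k / 2 * om ^+ 2 + G ^+ 2 * Z ^+ 2 / 2.
  apply: (@le_trans _ _ (`|om| * (G * Z))).
    rewrite (le_trans (ler_norm _))// normrM ler_wpM2l// (le_trans (ler_normD _ _))//.
    by rewrite normrN normrM ger0_norm//; lra.
  have -> : om ^+ 2 = `|om| ^+ 2 by rewrite real_normK ?num_real.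
  have : 0 <= (`|om| - G * Z) ^+ 2 by rewrite sqr_ge0.
  have := sqr_ge0 `|om|; nra.
have h2 : Z ^+ 2 <= X * Z by rewrite expr2 ler_wpM2r.
have h3 : - h * de <= H0 * (B * Z).
  by rewrite (le_trans (ler_norm _))// normrM normrN ler_pM.
have h4 : h * ze <= H0 * Z.
  by rewrite (le_trans (ler_norm _))// normrM ler_pM.
have h5 := ler_wpM2l c0 h4.
have h6 := ler_wpM2l H10 zeZ.
have h7 := ler_wpM2r Z0 hb.
have h8 := ler_wpM2l (ltW b0) hde.
have h9 := ler_wpM2l (sqr_ge0 G) h2.
lra.
Qed.

(* [lra] misses that norms elaborated through different instance paths agree. *)
Ltac norm_lra :=
  repeat match goal with |- context [@Num.norm _ _ ?v] => move: `|v| => ? end; lra.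

Section Decay.
Unset Implicit Arguments.
Context {R : realType} {N : nat}.
Variables (t0 : R) (f g : 'I_N -> 'rV[R]_N -> R) (d d' d'' : 'I_N -> R -> R).
Variables (a : 'M[R]_N) (theta : R) (thb : 'I_N -> 'I_N -> R) (ks c b : 'I_N -> R).
Variables (x : R -> 'rV[R]_N) (y : R -> 'M[R]_N) (xh zh : R -> 'rV[R]_N).
Variables (xs : 'rV[R]_N) (T : \bar R).
Variables (m P pp Tb abar lam B rho r Bd kc : R).
Local Notation n := (N%:R : R).
Local Notation th := (fun i j => theta * thb i j).
Implicit Types (i j k : 'I_N) (t : R).

Hypothesis sol : closed_loop_solution t0 f g d a th ks c b x y xh zh T.
Hypothesis fC : forall i, C2 (f i).
Hypothesis gC : forall i, C2 (g i).
Hypothesis dd : forall i t, t0 <= t -> has_deriv_from t0 (d i) t (d' i t).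
Hypothesis dd' : forall i t, t0 <= t -> has_deriv_from t0 (d' i) t (d'' i t).
Hypothesis m0 : 0 < m.
Hypothesis mono : forall u v : 'rV[R]_N, m * \sum_i (u 0 i - v 0 i) ^+ 2 <=
  \sum_i (u 0 i - v 0 i) * (partial i (f i) u - partial i (f i) v).
Hypothesis stat : forall i, partial i (f i) xs = 0.
Hypothesis B0 : 0 <= B.
Hypothesis r0 : 0 < r.
Hypothesis rhoP : forall k, `|xs 0 k| + 2 * r <= rho.
Local Notation box z := (forall k, `|z 0 k| <= rho).
Hypothesis fB : forall i k (z : 'rV[R]_N), box z -> `|partial k (partial i (f i)) z| <= B.
Hypothesis gB1 : forall i j (z : 'rV[R]_N), box z -> `|partial j (g i) z| <= B.
Hypothesis gB2 : forall i j k (z : 'rV[R]_N), box z -> `|partial k (partial j (g i)) z| <= B.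
Hypothesis dB1 : forall i t, t0 <= t -> `|d' i t| <= Bd.
Hypothesis dB2 : forall i t, t0 <= t -> `|d'' i t| <= Bd.
Hypothesis thb0 : forall i j, 0 < thb i j.
Hypothesis thbP : forall i j, (thb i j)^-1 <= P.
Hypothesis thbp : forall i j, pp <= (thb i j)^-1.
Hypothesis thbT : forall i j, thb i j <= Tb.
Hypothesis P1 : 1 <= P.
Hypothesis pp0 : 0 < pp.
Hypothesis pp1 : pp <= 1.
Hypothesis aP : forall i j, 0 <= a i j <= abar.
Hypothesis lamP : forall j v, lam * \sum_i v i ^+ 2 <= pinned_form a j v.
Hypothesis theta0 : 0 < theta.
Hypothesis thetaP : B ^+ 2 * n / m + P * B * n + P ^+ 2 * B ^+ 2 * n ^+ 3 / m + m / 2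
  <= theta * lam.
Hypothesis ks1 : forall i, 1 <= ks i.
Hypothesis cks : forall i, ks i <= c i.
Hypothesis cth : forall i, theta * abar * n <= c i.
Hypothesis cB : forall i, 2 * n * (B + 1) <= c i.
Hypothesis kcP : forall i, ks i + c i <= kc.

(** From here on, bounds on the region for [pgrad], [slow_drift], [track_vel], [cons_vel] and
    [slow_drift_vel], in this order; the last has a summand 1 to be strict. *)
Definition gmax : R := 2 * B * n * r.
Definition h0max : R := Bd + n * (B * gmax).
Definition vlmax : R := gmax + kc * r.
Definition vymax : R := theta * Tb * (n * (abar * (2 * r)) + abar * (2 * r)).
Definition h1max : R := Bd + n * (n * (B * vlmax) * gmax + B * (n * (B * vymax))) + 1.
(** All but the last summand are what [fast_decay] asks of [b], with [c i <= kc]. The last,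
    [2 * h0max], makes the cross term of [obs_energy] at most half of [b i * |obs_err i|]. *)
Definition bmin : R := (2 * B * kc) ^+ 2 * (n * r) / 2 + h0max * B + h0max * kc + h1max + 2 * h0max.
Hypothesis bP : forall i, bmin <= b i.

Local Notation e := (track_err xh xs).
Local Notation et := (cons_err y xh).
Local Notation ze := (obs_err x xh).
Local Notation ph := (pgrad f y).
Local Notation om := (filtered g d ks x xh zh).
Local Notation de := (fast_gap g x xh).
Local Notation h0 := (slow_drift f g d' y xh).
Local Notation fa := (obs_drift g ks c x xh).
Local Notation Z t := (\sum_j `|ze j t|).

Definition in_region t := [/\ forall i, `|e i t| <= r, forall i j, `|et i j t| <= r
  & forall i, `|ze i t| <= r].

Lemma ler_sum_bound (F : 'I_N -> R) (M : R) : (forall i, F i <= M) -> \sum_i F i <= n * M.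
Proof. by move=> h; rewrite -sum_cst; apply: ler_sum => i _. Qed.

Lemma norm_sum_bound (F : 'I_N -> R) (M : R) : (forall i, `|F i| <= M) -> `|\sum_i F i| <= n * M.
Proof. by move=> h; rewrite (le_trans (ler_norm_sum _ _ _))// ler_sum_bound. Qed.

Section Region.
Variable t : R.
Hypotheses (t0t : t0 <= t) (tT : (t%:E < T)%E) (hreg : in_region t).
Let er i : `|e i t| <= r. Proof. by case: hreg. Qed.
Let etr i j : `|et i j t| <= r. Proof. by case: hreg. Qed.
Let zer i : `|ze i t| <= r. Proof. by case: hreg. Qed.

Lemma box_xs : box xs.
Proof. by move=> k; rewrite (le_trans _ (rhoP k))// lerDl mulr_ge0// ltW. Qed.

Lemma box_xh : box (xh t).
Proof.
move=> k; have := rhoP k; have := er k.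
have -> : xh t 0 k = xs 0 k + e k t by rewrite /track_err; ring.
have := ler_normD (xs 0 k) (e k t); have := r0; norm_lra.
Qed.

Lemma box_x : box (x t).
Proof.
move=> k; have := rhoP k; have := er k; have := zer k.
have -> : x t 0 k = xs 0 k + e k t + ze k t by rewrite /track_err /obs_err; ring.
have := ler_normD (xs 0 k + e k t) (ze k t); have := ler_normD (xs 0 k) (e k t); have := r0; norm_lra.
Qed.

Lemma box_y i : box (row i (y t)).
Proof.
move=> k; have := rhoP k; have := er k; have := etr i k; rewrite mxE.
have -> : y t i k = xs 0 k + e k t + et i k t by rewrite /track_err /cons_err; ring.
have := ler_normD (xs 0 k + e k t) (et i k t); have := ler_normD (xs 0 k) (e k t); have := r0; norm_lra.
Qed.

Lemma pgrad_le i : `|ph i t| <= B * \sum_k (`|et i k t| + `|e k t|).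
Proof.
have := C1_lip ((fC i).2 i) (fun k z => fB i k z) box_xs (box_y i).
rewrite stat subr0 => /le_trans; apply; rewrite ler_wpM2l//; apply: ler_sum => k _.
rewrite mxE (_ : y t i k - xs 0 k = et i k t + e k t) ?ler_normD//.
by rewrite /track_err /cons_err; ring.
Qed.

Lemma pgrad_max i : `|ph i t| <= gmax.
Proof.
apply: le_trans (pgrad_le i) _.
rewrite /gmax (_ : 2 * B * n * r = B * (n * (2 * r))); last by ring.
rewrite ler_wpM2l// ler_sum_bound// => k.
have := etr i k; have := er k; norm_lra.
Qed.

(** Monotonicity applies at the common point [xh], while player [i] evaluates its gradient at its
    own row of [y]; the subtracted product bounds the discrepancy. *)
Lemma pgrad_mono :
  m * \sum_i e i t ^+ 2 - B * \sum_i `|e i t| * \sum_j `|et i j t| <= \sum_i e i t * ph i t.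
Proof.
rewrite lerBlDr.
apply: (le_trans (mono (xh t) xs)).
rewrite mulr_sumr -big_split; apply: ler_sum => i _ /=.
rewrite stat subr0 -/(e i t) -lerBlDl -mulrBr.
rewrite (le_trans (ler_norm _))// normrM mulrCA ler_wpM2l//.
rewrite distrC; have := C1_lip ((fC i).2 i) (fun k z => fB i k z) box_xh (box_y i).
move=> /le_trans; apply; rewrite ler_wpM2l//; apply: ler_sum => k _.
by rewrite mxE /cons_err.
Qed.

Lemma mism_le i : `|de i t| <= B * Z t.
Proof. exact: (C1_lip (gC i).1 (fun k z => gB1 i k z) box_xh box_x). Qed.

Lemma slow_max i : `|h0 i t| <= h0max.
Proof.
rewrite /slow_drift /h0max (le_trans (ler_normB _ _))// lerD ?dB1// norm_sum_bound// => j.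
by rewrite normrM ler_pM// ?gB1 ?pgrad_max//; exact: box_xh.
Qed.

Lemma kappa0 i : 0 <= ks i + c i.
Proof. have := ks1 i; have := cks i; lra. Qed.

Lemma fast_le i : `|fa i t| <= B * kc * Z t.
Proof.
rewrite /obs_drift (le_trans (ler_norm_sum _ _ _))// mulr_sumr; apply: ler_sum => j _.
rewrite !normrM (ger0_norm (kappa0 j)) -mulrA ler_pM// ?mulr_ge0 ?kappa0 ?gB1//.
  exact: box_xh.
by rewrite ler_wpM2r.
Qed.

Lemma vlead_max i : `|track_vel f ks c x y xh i t| <= vlmax.
Proof.
rewrite /track_vel (le_trans (ler_normD _ _))// normrN lerD ?pgrad_max//.
by rewrite normrM (ger0_norm (kappa0 i)) ler_pM ?kappa0.
Qed.

Lemma vy_max i j : `|cons_vel a th x y xh i j t| <= vymax.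
Proof.
have /andP[a0 a1] := aP i j.
have abar0 : 0 <= abar by exact: le_trans a1.
have t0' : 0 <= theta * thb i j by rewrite mulr_ge0// ltW.
rewrite /cons_vel normrM normrN (ger0_norm t0') /vymax ler_pM//.
  by rewrite ler_wpM2l// ltW.
have tri (u v : R) : `|u| <= r -> `|v| <= r -> `|u - v| <= 2 * r.
  by move=> hu hv; move: hu hv; have := ler_normB u v; norm_lra.
rewrite (le_trans (ler_normD _ _))// lerD//.
  apply: norm_sum_bound => k; have /andP[b0 b1] := aP i k.
  by rewrite normrM (ger0_norm b0) ler_pM// tri.
by rewrite normrM (ger0_norm a0) ler_pM// tri.
Qed.

Lemma vslow_max i : `|slow_drift_vel f g d'' a th ks c x y xh i t| < h1max.
Proof.
rewrite /h1max ltr_pwDr// /slow_drift_vel (le_trans (ler_normB _ _))// lerD ?dB2//.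
apply: norm_sum_bound => j; rewrite (le_trans (ler_normD _ _))// lerD//.
  rewrite normrM ler_pM// ?pgrad_max//; apply: norm_sum_bound => k.
  by rewrite normrM ler_pM// ?gB2 ?vlead_max//; exact: box_xh.
rewrite normrM ler_pM// ?gB1//; first exact: box_xh.
apply: norm_sum_bound => k.
by rewrite normrM ler_pM// ?fB ?vy_max//; exact: box_y.
Qed.

Lemma Z_max : Z t <= n * r.
Proof. exact: ler_sum_bound. Qed.

Lemma obs_Z i : `|ze i t| <= Z t.
Proof. exact: (@ler_term _ _ (fun j => `|ze j t|)). Qed.

Lemma max_ge0 i : [/\ 0 <= h0max, 0 <= h1max & h0max * 2 <= bmin].
Proof.
have H0 : 0 <= h0max by exact: le_trans (slow_max i).
have H1 : 0 <= h1max by exact: le_trans (ltW (vslow_max i)).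
have kc0 : 0 <= kc by apply: le_trans (kcP i); exact: kappa0.
split => //; rewrite /bmin.
have : 0 <= (2 * B * kc) ^+ 2 * (n * r) / 2.
  by rewrite divr_ge0// mulr_ge0 ?sqr_ge0// mulr_ge0// ltW.
have := mulr_ge0 H0 B0; have := mulr_ge0 H0 kc0; lra.
Qed.

End Region.

(** The weights [(thb i j)^-1] match [consensus_decay]; [theta] is left out so that it does not
    affect the initial value. *)
Definition slow_energy t : R :=
  2^-1 * (\sum_i e i t ^+ 2) + 2^-1 * \sum_i \sum_j (thb i j)^-1 * et i j t ^+ 2.
Definition obs_energy i t : R := om i t ^+ 2 / 2 + b i * `|ze i t| - ze i t * h0 i t.
(** By the bounds on [c], [(1 + P * n) * (ks j + c j) + theta * abar * n <= (3 + 2 * P * n) * c j],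
    so the input to [slow_energy] is at most [weight / 4] times the sum of [c j * |obs_err j|]. The
    fast part gives back twice as much, and the surplus enters the decay of [lyap]. *)
Definition weight : R := 4 * r * (3 + 2 * P * n).
Definition lyap t : R := slow_energy t + weight * \sum_i (b i)^-1 * obs_energy i t.
(** The comparison of [lyap] with the errors is established inside the region only, so a small
    [lyap] cannot by itself prove membership. [lower] has no term of variable sign and can. *)
Definition lower t : R := slow_energy t + weight / 2 * Z t.
(** [m / P] compares the decay [m / 2] with the factor [P / 2] of [slow_energy_upper]; [6^-1]
    compares [c i / 4], where [1 <= c i], with the [3 / 2] of [lyap_upper]. *)
Definition rate : R := Num.min (m / P) 6^-1.

Let P0 : 0 <= P. Proof. by rewrite (le_trans ler01). Qed.
Let W0 : 0 <= weight.
Proof. by rewrite /weight !mulr_ge0 ?(ltW r0)// addr_ge0// !mulr_ge0. Qed.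

Section Region2.
Variable t : R.
Hypotheses (t0t : t0 <= t) (tT : (t%:E < T)%E).

Lemma slow_energy_rderiv : rderiv slow_energy t
  (\sum_i e i t * (- ph i t + (ks i + c i) * ze i t) +
   \sum_i \sum_j et i j t * (- (theta * thb i j) *
      (\sum_k a i k * (et i j t - et k j t) + a i j * (et i j t - ze j t))
      - (- ph j t + (ks j + c j) * ze j t)) / thb i j).
Proof.
have h1 := rderiv_sum (fun i => rderivM (lead_rderiv xs sol t0t tT i)
  (lead_rderiv xs sol t0t tT i)).
have h2 := rderiv_sum (fun i => rderiv_sum (fun j => rderivZ (k := (thb i j)^-1)
  (rderivM (disa_rderiv sol t0t tT i j)
  (disa_rderiv sol t0t tT i j)))).
apply: rderiv_eq (rderivD (rderivZ (k := 2^-1) h1) (rderivZ (k := 2^-1) h2)) _.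
rewrite /track_vel /cons_vel !mulr_sumr; congr (_ + _); apply: eq_bigr => i _.
  by field.
rewrite mulr_sumr; apply: eq_bigr => j _.
by field; rewrite gt_eqF.
Qed.

Hypothesis hreg : in_region t.

Lemma b_gt0 i : 0 < b i.
Proof.
have [h1 h2 h3] := max_ge0 t t0t hreg i.
have := bP i; have : 0 < bmin; last by exact: lt_le_trans.
have h4 := vslow_max t t0t hreg i.
rewrite /bmin.
have kc0 : 0 <= kc by apply: le_trans (kcP i); exact: kappa0.
have : 0 <= (2 * B * kc) ^+ 2 * (n * r) / 2.
  by rewrite divr_ge0// mulr_ge0 ?sqr_ge0// mulr_ge0// ltW.
have : 0 < h1max by exact: le_lt_trans h4.
have := mulr_ge0 h1 B0; have := mulr_ge0 h1 kc0; lra.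
Qed.

Let b0 i : 0 < b i. Proof. exact: b_gt0. Qed.

Lemma slow_energy_decay :
  \sum_i e i t * (- ph i t + (ks i + c i) * ze i t) +
   \sum_i \sum_j et i j t * (- (theta * thb i j) *
      (\sum_k a i k * (et i j t - et k j t) + a i j * (et i j t - ze j t))
      - (- ph j t + (ks j + c j) * ze j t)) / thb i j
  <= - (m / 2) * (\sum_i e i t ^+ 2 + \sum_i \sum_j et i j t ^+ 2)
     + weight / 4 * \sum_j c j * `|ze j t|.
Proof.
have [er etr zer] := hreg.
have := @slow_decay R N m B P abar theta lam r a thb (e^~ t) (ph^~ t) (fun i => ks i + c i)
  (ze^~ t) (fun i j => et i j t) m0 B0 P0 theta0 thb0 thbP aP lamP er etr
  kappa0 (pgrad_mono t hreg) (pgrad_le t hreg) thetaP.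
move=> /le_trans; apply; rewrite lerD2l.
have -> : weight / 4 * (\sum_j c j * `|ze j t|) =
    r * \sum_j ((3 + 2 * P * n) * c j) * `|ze j t|.
  by rewrite !mulr_sumr; apply: eq_bigr => j _; rewrite /weight; field.
rewrite ler_wpM2l ?(ltW r0)//; apply: ler_sum => j _; rewrite ler_wpM2r//.
have h := cks j; have h1 := cth j.
have h2 : (1 + P * n) * (ks j + c j) <= (1 + P * n) * (2 * c j).
  by rewrite ler_wpM2l ?addr_ge0 ?mulr_ge0//; lra.
lra.
Qed.

(** Every player contributes [(B + 1) * Z t], which contains the observation errors of all players;
    by [cB], half of the decay terms [c i * |obs_err i|] pays for the total. *)
Lemma obs_energy_decay :
  dini_le (fun s => \sum_i (b i)^-1 * obs_energy i s) t
    (- (\sum_i ks i / 2 * ((b i)^-1 * om i t ^+ 2)) - 2^-1 * \sum_i c i * `|ze i t|).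
Proof.
have [er etr zer] := hreg.
have c0 i : 0 <= c i by have := ks1 i; have := cks i; lra.
apply: (@dini_leW _ _ _ (\sum_i (- (ks i / 2 * ((b i)^-1 * om i t ^+ 2)) - c i * `|ze i t| + (B + 1) * Z t))).
  have -> : \sum_i (- (ks i / 2 * ((b i)^-1 * om i t ^+ 2)) - c i * `|ze i t| + (B + 1) * Z t) =
    - (\sum_i ks i / 2 * ((b i)^-1 * om i t ^+ 2)) + (- (\sum_i c i * `|ze i t|) + n * (B + 1) * Z t).
    by rewrite -mulrA -sum_cst -!sumrN -!big_split; apply: eq_bigr => i _ /=; ring.
  rewrite lerD2l.
  have : n * (B + 1) * Z t <= 2^-1 * \sum_i c i * `|ze i t|.
    rewrite !mulr_sumr; apply: ler_sum => i _; rewrite mulrA ler_wpM2r//.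
    have := cB i; lra.
  move: (\sum_i c i * `|ze i t|) (n * (B + 1) * Z t) => u v; lra.
apply: dini_le_sum => i.
have [H0 H1 H2] := max_ge0 t t0t hreg i.
have bi := b0 i.
have := energy_dini sol fC gC dd dd' (fun i => ltW (b0 i)) t0t tT i h1max (vslow_max t t0t hreg i).
have bi' : 0 <= (b i)^-1 by rewrite invr_ge0 ltW.
move=> /(dini_leZ bi'); apply: dini_leW.
(* In [2 * B * kc], one [B * kc] is for [ks i * fast_gap i] and the other for [obs_drift i]. *)
apply: (@fast_decay R _ _ _ _ _ _ _ _ _ _ (2 * B * kc) h0max h1max (n * r)) => //.
- by rewrite !mulr_ge0// (le_trans (kappa0 i)).
- exact: mism_le.
- have h1 := ler_wpM2l (le_trans ler01 (ks1 i)) (mism_le t hreg i).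
  have h2 := fast_le t hreg i.
  have h3 : ks i * (B * Z t) <= kc * (B * Z t).
    by rewrite ler_wpM2r ?mulr_ge0 ?sumr_ge0//; have := kcP i; have := c0 i; lra.
  rewrite (_ : 2 * B * kc * Z t = kc * (B * Z t) + B * kc * Z t); last by ring.
  by rewrite lerD// (le_trans h1).
- exact: Z_max.
- exact: obs_Z.
- exact: slow_max t0t hreg i.
- apply: le_trans (bP i); rewrite /bmin.
  have : h0max * c i <= h0max * kc.
    by rewrite ler_wpM2l//; have := kcP i; have := ks1 i; lra.
  lra.
Qed.

(** As [2 * h0max <= b i], the cross term of [obs_energy] takes at most half of [b i * |obs_err i|];
    the same comparison serves in [lyap_upper]. *)
Lemma lyap_lower :
  slow_energy t + weight * \sum_i ((b i)^-1 * om i t ^+ 2 / 2 + `|ze i t| / 2) <= lyap t.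
Proof.
rewrite /lyap lerD2l ler_wpM2l//; apply: ler_sum => i _.
have [H0 H1 H2] := max_ge0 t t0t hreg i; have bi := b0 i.
have h1 : ze i t * h0 i t <= `|ze i t| * (b i / 2).
  rewrite (le_trans (ler_norm _))// normrM ler_wpM2l// (le_trans (slow_max t t0t hreg i))//.
  have := bP i; lra.
rewrite -(ler_pM2l bi) mulVKf ?gt_eqF// /obs_energy.
rewrite [leLHS](_ : _ = om i t ^+ 2 / 2 + `|ze i t| * (b i / 2)); last by field; rewrite gt_eqF.
move: h1; move: `|ze i t| (ze i t * h0 i t) (om i t ^+ 2) => u v w; lra.
Qed.

Lemma lyap_upper :
  lyap t <= slow_energy t + weight * \sum_i ((b i)^-1 * om i t ^+ 2 / 2 + 3 / 2 * `|ze i t|).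
Proof.
rewrite /lyap lerD2l ler_wpM2l//; apply: ler_sum => i _.
have [H0 H1 H2] := max_ge0 t t0t hreg i; have bi := b0 i.
have h1 : - ze i t * h0 i t <= `|ze i t| * (b i / 2).
  rewrite (le_trans (ler_norm _))// normrM normrN ler_wpM2l// (le_trans (slow_max t t0t hreg i))//.
  have := bP i; lra.
rewrite -(ler_pM2l bi) mulVKf ?gt_eqF// /obs_energy.
rewrite [leRHS](_ : _ = om i t ^+ 2 / 2 + b i * `|ze i t| + `|ze i t| * (b i / 2)); last by field; rewrite gt_eqF.
move: h1; rewrite mulNr; move: `|ze i t| (ze i t * h0 i t) (om i t ^+ 2) => u v w; lra.
Qed.

Lemma rate_gt0 : 0 < rate.
Proof.
have Pp : 0 < P by exact: lt_le_trans ltr01 P1.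
by rewrite /rate lt_min divr_gt0//= invr_gt0.
Qed.

Lemma slow_energy_upper :
  slow_energy t <= P / 2 * (\sum_i e i t ^+ 2 + \sum_i \sum_j et i j t ^+ 2).
Proof.
rewrite /slow_energy.
have h1 : \sum_i \sum_j (thb i j)^-1 * et i j t ^+ 2 <= P * \sum_i \sum_j et i j t ^+ 2.
  rewrite mulr_sumr; apply: ler_sum => i _; rewrite mulr_sumr; apply: ler_sum => j _.
  by rewrite ler_wpM2r ?sqr_ge0.
have h2 : \sum_i e i t ^+ 2 <= P * \sum_i e i t ^+ 2.
  by rewrite ler_peMl// sumr_ge0// => i _; rewrite sqr_ge0.
lra.
Qed.

Lemma lyap_decay : dini_le lyap t (- rate * lyap t).
Proof.
have hs := dini_leD (rderiv_dini slow_energy_rderiv) (dini_leZ W0 obs_energy_decay).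
apply: dini_leW hs.
apply: le_trans (lerD slow_energy_decay (lexx _)) _.
have rm : rate * P <= m.
  by rewrite -ler_pdivlMr ?(lt_le_trans ltr01)// /rate ge_min lexx.
have r6 : rate <= 6^-1 by rewrite /rate ge_min lexx orbT.
have rt := rate_gt0.
rewrite [leRHS]mulNr lerNr.
apply: le_trans (ler_wpM2l (ltW rt) lyap_upper) _.
rewrite mulrDr.
have h1 := ler_wpM2l (ltW rt) slow_energy_upper.
pose Q := \sum_i e i t ^+ 2 + \sum_i \sum_j et i j t ^+ 2.
have Q0 : 0 <= Q.
  by rewrite addr_ge0// sumr_ge0// => i _; rewrite ?sqr_ge0// sumr_ge0// => j _; rewrite sqr_ge0.
have h2 := ler_wpM2r Q0 rm.
(* The right side is what remains of the fast decay once [weight / 4] has paid for the slow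
   input. *)
have h3 : rate * (weight * \sum_i ((b i)^-1 * om i t ^+ 2 / 2 + 3 / 2 * `|ze i t|)) <=
    weight * (\sum_i ks i / 2 * ((b i)^-1 * om i t ^+ 2)) + weight / 4 * \sum_i c i * `|ze i t|.
  rewrite mulrCA [X in _ <= _ + X](_ : _ = weight * \sum_i c i / 4 * `|ze i t|); last first.
    by rewrite -mulrA; congr (_ * _); rewrite mulr_sumr; apply: eq_bigr => i _; field.
  rewrite -mulrDr ler_wpM2l// mulr_sumr -big_split; apply: ler_sum => i _ /=.
  rewrite mulrDr lerD//.
    rewrite (_ : rate * _ = rate / 2 * ((b i)^-1 * om i t ^+ 2)); last by field; rewrite gt_eqF.
    rewrite ler_wpM2r//; first by rewrite mulr_ge0 ?sqr_ge0// invr_ge0 ltW.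
    have := ks1 i; lra.
  rewrite mulrA ler_wpM2r//; have := ks1 i; have := cks i; lra.
rewrite -/Q in h1 *.
move: h1 h2 h3.
move: (\sum_i c i * `|ze i t|) (\sum_i ks i / 2 * ((b i)^-1 * om i t ^+ 2)) => u v.
move: (weight * \sum_i _) => w; lra.
Qed.


Lemma lower_lyap : lower t <= lyap t.
Proof.
apply: le_trans lyap_lower; rewrite /lower lerD2l -mulrA ler_wpM2l// mulr_sumr.
apply: ler_sum => i _; rewrite mulrC ler_wpDl// divr_ge0// mulr_ge0 ?sqr_ge0//.
by rewrite invr_ge0 ltW.
Qed.

Lemma lyap_upper_init v : (forall i, `|ze i t| <= v) -> (forall i, om i t ^+ 2 <= b i * v) ->
  lyap t <= slow_energy t + weight * (n * (2 * v)).
Proof.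
move=> hv ho; apply: le_trans lyap_upper _; rewrite lerD2l ler_wpM2l//.
apply: ler_sum_bound => i.
have h1 : (b i)^-1 * om i t ^+ 2 <= v by rewrite ler_pdivrMl.
move: (hv i) h1; move: `|ze i t| ((b i)^-1 * om i t ^+ 2) => u w; lra.
Qed.

End Region2.

(** The level is set by the consensus errors, whose weights are at least [pp]. It also suits the
    observation errors because [weight] is linear in [r]: [weight / 2] is at least [6 * r], against
    a level of order [r ^+ 2]. *)
Lemma lower_region t : lower t <= pp * r ^+ 2 / 2 -> in_region t.
Proof.
move=> h.
have sq (u : R) : u ^+ 2 <= r ^+ 2 -> `|u| <= r.
  by rewrite -(real_normK (num_real u)) ler_pXn2r// nnegrE ltW.
have E0 : 0 <= \sum_i e i t ^+ 2 by apply: sumr_ge0 => i _; rewrite sqr_ge0.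
have nt i j : 0 <= (thb i j)^-1 * et i j t ^+ 2.
  by rewrite mulr_ge0 ?sqr_ge0// invr_ge0 ltW.
have ns i : 0 <= \sum_j (thb i j)^-1 * et i j t ^+ 2 by apply: sumr_ge0 => j _; exact: nt.
have H0 : 0 <= \sum_i \sum_j (thb i j)^-1 * et i j t ^+ 2.
  by apply: sumr_ge0 => i _; exact: ns.
have Z0 : 0 <= weight / 2 * Z t by rewrite mulr_ge0 ?divr_ge0 ?sumr_ge0.
have pr : pp * r ^+ 2 <= r ^+ 2 by rewrite ler_piMl ?sqr_ge0.
move: h; rewrite /lower /slow_energy => h.
split=> [i|i j|i].
- apply: sq.
  have /= := @ler_term _ _ (fun i => e i t ^+ 2) i (fun i => sqr_ge0 _).
  lra.
- apply: sq.
  have /= h1 := @ler_term _ _ (fun i => \sum_j (thb i j)^-1 * et i j t ^+ 2) i ns.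
  have /= h2 := @ler_term _ _ (fun j => (thb i j)^-1 * et i j t ^+ 2) j (nt i).
  have h3 : pp * et i j t ^+ 2 <= (thb i j)^-1 * et i j t ^+ 2.
    by rewrite ler_wpM2r ?sqr_ge0.
  rewrite -(ler_pM2l pp0); lra.
- have h1 : `|ze i t| <= Z t by exact: obs_Z.
  have h2 : weight / 2 * `|ze i t| <= weight / 2 * Z t by rewrite ler_wpM2l ?divr_ge0.
  have h3 : 2 * r * (3 + 2 * P * n) * `|ze i t| <= r * r / 2.
    have -> : 2 * r * (3 + 2 * P * n) = weight / 2 by rewrite /weight; field.
    move: h2; move: `|ze i t| (Z t) Z0 h => u v; rewrite expr2 in pr *; lra.
  have h4 : 0 <= P * n by rewrite mulr_ge0.
  have h5 : 0 <= P * n * (r * `|ze i t|) by rewrite mulr_ge0// mulr_ge0// ltW.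
  have h6 : r * `|ze i t| <= r * r.
    have : 0 <= r * `|ze i t| by rewrite mulr_ge0// ltW.
    have : 0 < r * r by rewrite mulr_gt0.
    move: h3 h5; move: `|ze i t| => u; lra.
  by rewrite -(ler_pM2l r0).
Qed.

Section Continuity.
Hypothesis b0 : forall i, 0 <= b i.
Variable t : R.
Hypotheses (t0t : t0 <= t) (tT : (t%:E < T)%E).

Lemma slow_energy_cont : cont_from t0 slow_energy t.
Proof.
have ce i := lead_cont xs sol t0t tT i; have cet i j := disa_cont sol t0t tT i j.
apply: cont_fromD; apply: cont_fromM; try exact: cont_from_cst.
  by apply: cont_from_sum => i; apply: cont_fromM.
apply: cont_from_sum => i; apply: cont_from_sum => j.
by apply: cont_fromM; [exact: cont_from_cst|exact: cont_fromM].
Qed.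

Lemma abs_obs_cont i : cont_from t0 (fun s => `|ze i s|) t.
Proof. exact: cvg_norm (obs_cont sol t0t tT i). Qed.

Lemma lower_cont : cont_from t0 lower t.
Proof.
apply: cont_fromD; first exact: slow_energy_cont.
apply: cont_fromM; first exact: cont_from_cst.
by apply: cont_from_sum => i; exact: abs_obs_cont.
Qed.

Lemma lyap_cont : cont_from t0 lyap t.
Proof.
apply: cont_fromD; first exact: slow_energy_cont.
apply: cont_fromM; first exact: cont_from_cst.
apply: cont_from_sum => i; apply: cont_fromM; first exact: cont_from_cst.
have co := filt_cont sol gC dd b0 t0t tT i.
apply: cont_fromB; last first.
  by apply: cont_fromM; [exact: (obs_cont sol t0t tT i)|exact: (slow_cont sol fC gC dd' t0t tT i)].
apply: cont_fromD; apply: cont_fromM; try exact: cont_from_cst; last exact: abs_obs_cont.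
exact: cont_fromM.
Qed.

End Continuity.

(** As long as [lower] is at most the threshold, the state is in the region and [lyap] decays, so
    [lower <= lyap <= A] lies strictly below the threshold. This is the improvement that
    [cont_from_trap] asks for. *)
Lemma semiglobal_decay (A t : R) : (forall i, 0 <= b i) -> 0 < A -> A < pp * r ^+ 2 / 2 ->
  lower t0 <= pp * r ^+ 2 / 2 -> lyap t0 <= A -> t0 <= t -> (t%:E < T)%E ->
  in_region t /\ lyap t <= A / (1 + rate / 2 * (t - t0)).
Proof.
move=> b0 A0 Ar l0 hA t0t tT.
have T' s : s <= t -> (s%:E < T)%E by move=> st; apply: le_lt_trans tT; rewrite lee_fin.
have dec u : t0 <= u <= t -> (forall s, t0 <= s <= u -> lower s <= pp * r ^+ 2 / 2) ->
    lyap u <= A / (1 + rate / 2 * (u - t0)).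
  move=> /andP[u0 ut] hl; apply: dini_decay => //.
  - exact: rate_gt0.
  - by move=> s /andP[s0 su]; apply: lyap_cont => //; apply: T'; exact: le_trans ut.
  - move=> s /andP[s0 su] _; apply: lyap_decay => //.
      by apply: T'; apply: le_trans ut; exact: ltW.
    by apply: lower_region; apply: hl; rewrite s0 ltW.
have trap := @cont_from_trap _ t0 t (pp * r ^+ 2 / 2) lower t0t _ l0 _.
have low s : t0 <= s <= t -> lower s < pp * r ^+ 2 / 2.
  apply: trap.
    by move=> u /andP[u0 ut]; apply: lower_cont => //; exact: T'.
  move=> u /andP[u0 ut] hl.
  have ru : in_region u by apply: lower_region; apply: hl; rewrite u0 lexx.
  apply: le_lt_trans (lower_lyap u u0 ru) _; apply: le_lt_trans Ar.
  apply: le_trans (dec u _ hl) _; first by rewrite u0.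
  have h : 0 <= rate / 2 * (u - t0).
    by rewrite mulr_ge0 ?subr_ge0// divr_ge0// ltW// rate_gt0.
  by rewrite ler_pdivrMr; [rewrite ler_peMr ?(ltW A0)//; lra|lra].
split; first by apply/lower_region/ltW/low; rewrite t0t lexx.
apply: dec; first by rewrite t0t lexx.
by move=> s hs; apply/ltW/low.
Qed.

(** This constant may depend on all gains, since it only transfers the decay of [lyap] once the
    region is secured. [lyap] controls observation errors to the first power; their squares follow
    from the bound [r]. *)
Lemma error_lyap : exists C, 0 <= C /\ forall t, t0 <= t -> in_region t ->
  enorm (error g d ks x y xh zh xs t) ^+ 2 <= C * lyap t.
Proof.
pose w := weight.
have w0 : 0 < w.
  rewrite /w /weight !mulr_gt0// ltr_pwDl// !mulr_ge0//.
(* The summands serve, in order, the squares of [ze], [om], [e], [et] and [de]; [K] below is for the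
   term [ks i * ze i] of [zeta2]. *)
pose M := 2 * r / w + \sum_i 2 * `|b i| / w + 2 + 2 / pp + 2 * B ^+ 2 * n * r / w.
pose K := \sum_i ks i ^+ 2.
exists ((N + (N + (N + (N * N + N))))%:R * (3 * (2 + K) * M)).
have K0 : 0 <= K by apply: sumr_ge0 => i _; rewrite sqr_ge0.
have r0' := ltW r0; have w0' := ltW w0.
have M1 : 0 <= 2 * r / w by rewrite divr_ge0// mulr_ge0.
have M2i i : 0 <= 2 * `|b i| / w by rewrite divr_ge0// mulr_ge0.
have M2 : 0 <= \sum_i 2 * `|b i| / w by apply: sumr_ge0.
have M3 : 0 <= 2 / pp by rewrite divr_ge0// ltW.
have M4 : 0 <= 2 * B ^+ 2 * n * r / w.
  by rewrite divr_ge0// !mulr_ge0// sqr_ge0.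
have M0 : 0 <= M by rewrite /M; lra.
split; first by rewrite !mulr_ge0//; lra.
move=> t t0t hreg; have [er etr zer] := hreg.
have low := lyap_lower t t0t hreg.
have b0 i : 0 < b i.
  exact: (b_gt0 t).
set V := lyap t in low *.
have ot i : 0 <= (b i)^-1 * om i t ^+ 2 / 2.
  by rewrite divr_ge0// mulr_ge0 ?sqr_ge0// invr_ge0 ltW.
have zt i : 0 <= `|ze i t| / 2 by rewrite divr_ge0.
have sot : 0 <= \sum_i (b i)^-1 * om i t ^+ 2 / 2 by apply: sumr_ge0.
have szt : 0 <= \sum_i `|ze i t| / 2 by apply: sumr_ge0.
have E0 : 0 <= \sum_i e i t ^+ 2 by apply: sumr_ge0 => i _; rewrite sqr_ge0.
have nt i j : 0 <= (thb i j)^-1 * et i j t ^+ 2.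
  by rewrite mulr_ge0 ?sqr_ge0// invr_ge0 ltW.
have ns i : 0 <= \sum_j (thb i j)^-1 * et i j t ^+ 2 by apply: sumr_ge0 => j _; exact: nt.
have H0 : 0 <= \sum_i \sum_j (thb i j)^-1 * et i j t ^+ 2.
  by apply: sumr_ge0 => i _; exact: ns.
rewrite big_split /= in low.
have ho : w * \sum_i (b i)^-1 * om i t ^+ 2 / 2 <= V.
  have := mulr_ge0 (ltW w0) szt; move: low; rewrite mulrDr /slow_energy -/w.
  move: (w * \sum_i `|ze i t| / 2) (w * \sum_i (b i)^-1 * om i t ^+ 2 / 2) => u v; lra.
have hz : w * \sum_i `|ze i t| / 2 <= V.
  have := mulr_ge0 (ltW w0) sot; move: low; rewrite mulrDr /slow_energy -/w.
  move: (w * \sum_i `|ze i t| / 2) (w * \sum_i (b i)^-1 * om i t ^+ 2 / 2) => u v; lra.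
have hs : slow_energy t <= V.
  have := mulr_ge0 (ltW w0) sot; have := mulr_ge0 (ltW w0) szt; move: low; rewrite mulrDr -/w.
  move: (w * \sum_i `|ze i t| / 2) (w * \sum_i (b i)^-1 * om i t ^+ 2 / 2) => u v; lra.
have V0 : 0 <= V by apply: le_trans hz; rewrite mulr_ge0// ltW.
have zz : w * Z t <= 2 * V.
  move: hz; rewrite -mulr_suml; move: (Z t) => u; lra.
have Zw : Z t <= 2 / w * V by rewrite mulrAC ler_pdivlMr// mulrC.
have hze i : ze i t ^+ 2 <= M * V.
  have h1 : `|ze i t| <= Z t by exact: obs_Z.
  apply: (@le_trans _ _ (2 * r / w * V)); last by rewrite ler_wpM2r// /M; lra.
  rewrite -(real_normK (num_real _)) expr2 (_ : 2 * r / w * V = r * (2 / w * V)); last by ring.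
  by rewrite ler_pM//; exact: le_trans h1 Zw.
have hde i : de i t ^+ 2 <= M * V.
  have h1 := mism_le t hreg i.
  apply: (@le_trans _ _ (2 * B ^+ 2 * n * r / w * V)); last by rewrite ler_wpM2r// /M; lra.
  rewrite -(real_normK (num_real _)).
  apply: (@le_trans _ _ ((B * Z t) ^+ 2)).
    by rewrite lerXn2r// nnegrE// (le_trans _ h1).
  rewrite exprMn (_ : 2 * B ^+ 2 * n * r / w * V = B ^+ 2 * ((n * r) * (2 / w * V))); last by ring.
  by rewrite ler_wpM2l ?sqr_ge0// expr2 ler_pM ?sumr_ge0// Z_max.
have hom i : om i t ^+ 2 <= M * V.
  have h1 := @ler_term _ _ (fun i => (b i)^-1 * om i t ^+ 2 / 2) i ot.
  have h2 := @ler_term _ _ (fun i => 2 * `|b i| / w) i M2i.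
  apply: (@le_trans _ _ (2 * `|b i| / w * V)); last by rewrite ler_wpM2r// /M; move: h2 => /=; lra.
  have h3 : w * ((b i)^-1 * om i t ^+ 2 / 2) <= V.
    by apply: le_trans ho; rewrite ler_wpM2l// ltW.
  rewrite (gtr0_norm (b0 i)).
  have -> : om i t ^+ 2 = 2 * b i / w * (w * ((b i)^-1 * om i t ^+ 2 / 2)).
    by field; rewrite !gt_eqF.
  by apply: ler_wpM2l => //; apply: divr_ge0 => //; apply: mulr_ge0 => //; exact: ltW.
have hel i : e i t ^+ 2 <= M * V.
  have /= h1 := @ler_term _ _ (fun i => e i t ^+ 2) i (fun i => sqr_ge0 _).
  apply: (@le_trans _ _ (2 * V)); last by rewrite ler_wpM2r// /M; lra.
  move: hs; rewrite /slow_energy; lra.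
have het i j : et i j t ^+ 2 <= M * V.
  have /= h1 := @ler_term _ _ (fun i => \sum_j (thb i j)^-1 * et i j t ^+ 2) i ns.
  have /= h2 := @ler_term _ _ (fun j => (thb i j)^-1 * et i j t ^+ 2) j (nt i).
  have h3 : pp * et i j t ^+ 2 <= (thb i j)^-1 * et i j t ^+ 2.
    by rewrite ler_wpM2r ?sqr_ge0.
  apply: (@le_trans _ _ (2 / pp * V)); last by rewrite ler_wpM2r// /M; lra.
  rewrite mulrAC ler_pdivlMr// mulrC.
  move: hs; rewrite /slow_energy; lra.
have M0V : 0 <= M * V by rewrite mulr_ge0.
have KV : 0 <= K * (M * V) by rewrite mulr_ge0.
have sq2 (u v : R) : (u + v) ^+ 2 <= 2 * (u ^+ 2 + v ^+ 2).
  have : 0 <= (u - v) ^+ 2 by exact: sqr_ge0.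
  lra.
have sq3 (u v k : R) : (u + v + k) ^+ 2 <= 3 * (u ^+ 2 + v ^+ 2 + k ^+ 2).
  have : 0 <= (u - v) ^+ 2 by rewrite sqr_ge0.
  have : 0 <= (u - k) ^+ 2 by rewrite sqr_ge0.
  have : 0 <= (v - k) ^+ 2 by rewrite sqr_ge0.
  lra.
rewrite -[leRHS]mulrA -[3 * _ * M * V]mulrA; apply: error_sqr_le => [i|i|i|i j|i].
- rewrite !mxE -/(obs_err x xh i t); have := hze i; lra.
- rewrite !mxE (_ : _ - _ = om i t + de i t + ks i * ze i t); last first.
    by rewrite /uncertainty /filtered /fast_gap; ring.
  apply: le_trans (sq3 _ _ _) _.
  have /= h1 := @ler_term _ _ (fun i => ks i ^+ 2) i (fun i => sqr_ge0 _).
  have h2 : (ks i * ze i t) ^+ 2 <= K * (M * V).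
    by rewrite exprMn ler_pM ?sqr_ge0.
  have := hom i; have := hde i; lra.
- rewrite !mxE (_ : _ - _ = e i t + ze i t); last by rewrite /track_err /obs_err; ring.
  apply: le_trans (sq2 _ _) _; have := hel i; have := hze i; lra.
- rewrite !mxE (_ : _ - _ = et i j t + - ze j t); last by rewrite /cons_err /obs_err; ring.
  apply: le_trans (sq2 _ _) _; rewrite sqrrN; have := het i j; have := hze j; lra.
- rewrite !mxE (_ : _ - _ = om i t + de i t); last first.
    by rewrite /uncertainty /filtered /fast_gap /obs_err; ring.
  apply: le_trans (sq2 _ _) _; have := hom i; have := hde i; lra.
Qed.

(** The left side of the smallness condition bounds [lyap t0]; tracking and consensus errors start
    below [2 * v] since they are measured from [xh] rather than [x]. *)
Lemma closed_loop_stable (v : R) :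
  0 < v -> 2 * v <= r -> 0 < n ->
  2 * P * n * (n + 1) * v ^+ 2 + weight * (n * (2 * v)) < pp * r ^+ 2 / 2 ->
  (forall i, (1 + B * n) ^+ 2 * v <= b i) ->
  (t0%:E < T)%E -> enorm (error g d ks x y xh zh xs t0) <= v ->
  (exists M, forall t, t0 <= t -> (t%:E < T)%E ->
     enorm (error g d ks x y xh zh xs t) <= M) /\
  (T = +oo%E -> enorm (error g d ks x y xh zh xs t) @[t --> +oo] --> 0).
Proof.
move=> v0 vr n0 hA hb t0T herr.
set A := _ + _ in hA.
have [h1 _ h3 h4 h5] := entry_le_error g d ks x y xh zh xs t0.
have ze0 i : `|ze i t0| <= v.
  by have := le_trans (h1 i) herr; rewrite !mxE.
have e0 i : `|e i t0| <= 2 * v.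
  rewrite (_ : e i t0 = xi x xs t0 0 i - ze i t0); last by rewrite /track_err /obs_err !mxE; ring.
  apply: le_trans (ler_normB _ _) _; have := le_trans (h3 i) herr; have := ze0 i; norm_lra.
have et0 i j : `|et i j t0| <= 2 * v.
  rewrite (_ : et i j t0 = eta x y t0 i j + ze j t0); last by rewrite /cons_err /obs_err !mxE; ring.
  apply: le_trans (ler_normD _ _) _; have := le_trans (h4 i j) herr; have := ze0 j; norm_lra.
have reg0 : in_region t0.
  by split=> [i|i j|i]; rewrite (le_trans _ vr)//; have := ze0 i; have := normr_ge0 (ze i t0); norm_lra.
(* [om] is [gamma] minus [de], hence initially at most [(1 + B * n) * v]; the lower bound [hb] on
   [b i] is made for the square of this. *)
have om0 i : om i t0 ^+ 2 <= b i * v.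
  have Z0 : Z t0 <= n * v by exact: ler_sum_bound.
  have k1 : `|om i t0| <= (1 + B * n) * v.
    rewrite (_ : om i t0 = gamma g d ks x xh zh t0 0 i - de i t0); last first.
      by rewrite /filtered /fast_gap /obs_err !mxE /uncertainty; ring.
    apply: le_trans (ler_normB _ _) _; rewrite mulrDl mul1r -mulrA lerD ?(le_trans (h5 i))//.
    by rewrite (le_trans (mism_le t0 reg0 i))// ler_wpM2l.
  rewrite -(real_normK (num_real _)).
  apply: (@le_trans _ _ (((1 + B * n) * v) ^+ 2)).
    by rewrite lerXn2r// nnegrE// (le_trans _ k1).
  by rewrite exprMn [v ^+ 2]expr2 mulrA ler_wpM2r ?(ltW v0).
have P0' := lt_le_trans ltr01 P1.
have A0 : 0 < A.
  apply: ltr_pwDl; first by rewrite !mulr_gt0 ?exprn_gt0// addr_gt0.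
  by apply: mulr_ge0 => //; apply: mulr_ge0; [exact: ltW|apply: mulr_ge0; rewrite ?(ltW v0)].
have sq4 (u : R) : `|u| <= 2 * v -> u ^+ 2 <= 4 * v ^+ 2.
  move=> hu; rewrite -(real_normK (num_real u)).
  rewrite (_ : 4 * v ^+ 2 = (2 * v) ^+ 2); last by ring.
  by rewrite lerXn2r// nnegrE// mulr_ge0// ltW.
have lA : lyap t0 <= A.
  apply: le_trans (lyap_upper_init t0 (lexx t0) reg0 v ze0 om0) _; rewrite lerD2r.
  apply: le_trans (slow_energy_upper t0) _.
  have k1 : \sum_i e i t0 ^+ 2 <= n * (4 * v ^+ 2).
    by apply: ler_sum_bound => i; exact: sq4.
  have k2 : \sum_i \sum_j et i j t0 ^+ 2 <= n * (n * (4 * v ^+ 2)).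
    by apply: ler_sum_bound => i; apply: ler_sum_bound => j; exact: sq4.
  rewrite (_ : _ * v ^+ 2 = P / 2 * (n * (4 * v ^+ 2) + n * (n * (4 * v ^+ 2)))); last by field.
  by rewrite ler_wpM2l ?lerD// divr_ge0.
have low0 : lower t0 <= pp * r ^+ 2 / 2.
  exact: ltW (le_lt_trans (le_trans (lower_lyap t0 (lexx t0) reg0) lA) hA).
have b0 i : 0 <= b i by apply: le_trans (hb i); rewrite mulr_ge0 ?sqr_ge0 ?ltW.
have dec t (t0t : t0 <= t) tT := semiglobal_decay A t b0 A0 hA low0 lA t0t tT.
have [C [C0 hC]] := error_lyap.
have rt : 0 < rate / 2 by rewrite divr_gt0// rate_gt0.
have bnd t : t0 <= t -> (t%:E < T)%E ->
    enorm (error g d ks x y xh zh xs t) ^+ 2 <= C * (A / (1 + rate / 2 * (t - t0))).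
  move=> t0t tT; have [ht hl] := dec t t0t tT.
  by rewrite (le_trans (hC t t0t ht))// ler_wpM2l.
have den t : t0 <= t -> 1 <= 1 + rate / 2 * (t - t0).
  by move=> t0t; rewrite lerDl mulr_ge0 ?subr_ge0// ltW.
split.
  exists (Num.sqrt (C * A)) => t t0t tT.
  rewrite -(ger0_norm (enorm_ge0 _)) -sqrtr_sqr ler_wsqrtr//.
  apply: le_trans (bnd t t0t tT) _; rewrite ler_wpM2l// ler_pdivrMr.
    by rewrite ler_peMr ?(ltW A0)// den.
  exact: lt_le_trans (den t t0t).
move=> TE; apply/cvgrPdist_le => eps eps0; near=> t.
have t0t : t0 <= t by near: t; apply: nbhs_pinfty_ge; exact: num_real.
have tT : (t%:E < T)%E by rewrite TE ltry.
have den0 : 0 < 1 + rate / 2 * (t - t0) by exact: lt_le_trans (den t t0t).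
rewrite sub0r normrN (ger0_norm (enorm_ge0 _)).
rewrite -(@ler_pXn2r _ 2)// ?nnegrE ?enorm_ge0 ?(ltW eps0)//.
apply: le_trans (bnd t t0t tT) _.
rewrite mulrA ler_pdivrMr// [leRHS]mulrC -ler_pdivrMr ?exprn_gt0//.
apply: (@le_trans _ _ (rate / 2 * (t - t0))); last by rewrite lerDr.
rewrite [leRHS]mulrC -ler_pdivrMr// lerBrDr; near: t.
by apply: nbhs_pinfty_ge; exact: num_real.
Unshelve. all: by end_near. Qed.

End Decay.

(** * Choice of the gains *)

Set Implicit Arguments.

Lemma le_sum2 (R : realType) (N : nat) (F : 'I_N -> 'I_N -> R) i j :
  (forall i j, 0 <= F i j) -> F i j <= \sum_i \sum_j F i j.
Proof.
move=> F0; apply: le_trans (ler_term j (F0 i)) _.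
by apply: (ler_term (F := fun i => \sum_j F i j)) => k; apply: sumr_ge0.
Qed.


(* The weight is linear in [r], so that the initial energy, of order
   [v ^ 2 + r * v], falls below the quadratic threshold for large [r]. *)
Lemma radius_exists (R : realType) (N : nat) (P pp v : R) :
  1 <= P -> 0 < pp -> 1 <= N%:R :> R -> 0 < v ->
  exists r, 2 * v <= r /\
    2 * P * N%:R * (N%:R + 1) * v ^+ 2 + @weight R N P r * (N%:R * (2 * v))
    < pp * r ^+ 2 / 2.
Proof.
rewrite /weight; move: (N%:R : R) => n P1 pp0 n1 v0.
pose D : R := 3 + 2 * P * n.
(* With [r = c0 * v] and [pp * c0 = X + 2 * pp], the threshold is [(X + 2 * pp) / 2 * c0 * v ^+ 2].
   Already [X / 2 * c0] dominates [2 * P * n * (n + 1) + 8 * D * n * c0], as [1 <= c0]; the summand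
   [2 * pp] makes the inequality strict. *)
pose X : R := 4 * P * n * (n + 1) + 20 * D * n.
have Pn1 : 1 * 1 <= P * n by rewrite ler_pM.
have D0 : 0 <= D * n by rewrite mulr_ge0 /D; lra.
have Pn0 : 0 <= P * n * (n + 1) by rewrite mulr_ge0; lra.
have X0 : 0 <= X by rewrite /X; lra.
pose c0 : R := X / pp + 2.
have Xpp : 0 <= X / pp by rewrite divr_ge0// ltW.
have c02 : 2 <= c0 by rewrite /c0; lra.
exists (c0 * v); split; first by rewrite ler_wpM2r// ltW.
rewrite -/D.
have -> : pp * (c0 * v) ^+ 2 / 2 = (X + 2 * pp) / 2 * c0 * v ^+ 2.
  by rewrite /c0; field; rewrite gt_eqF.
have -> : 2 * P * n * (n + 1) * v ^+ 2 + 4 * (c0 * v) * D * (n * (2 * v)) =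
  (2 * (P * n * (n + 1)) + 8 * (D * n) * c0) * v ^+ 2 by ring.
rewrite ltr_pM2r ?exprn_gt0// /X.
have h2 : 0 <= P * n * (n + 1) * (c0 - 1) by rewrite mulr_ge0//; lra.
have h3 : 0 <= D * n * c0 by rewrite mulr_ge0//; lra.
have h4 : 0 < pp * c0 by rewrite mulr_gt0//; lra.
lra.
Qed.

Lemma lt_add_terms (R : realType) (x y z w : R) : 0 <= x -> 0 <= y -> 0 <= z ->
  1 + x + y + z < w -> [/\ x <= w, y <= w & z <= w].
Proof. by move=> x0 y0 z0 h; split; lra. Qed.


(** Radius, box and derivative bound [B] are fixed before any gain, and each gain threshold uses
    only what precedes it. Boundedness is stated for every horizon [T], convergence for global
    solutions. *)
Theorem theorem2 (R : realType) (N : nat) (hN : (2 <= N)%N)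
  (t0 : R) (f g : 'I_N -> 'rV[R]_N -> R) (d : 'I_N -> R -> R)
  (a : 'M[R]_N) (thbar : 'I_N -> 'I_N -> R) (xs : 'rV[R]_N)
  (hgraph : weighted_graph a)
  (hthbar : forall i j, 0 < thbar i j)
  (hxs : is_nash f xs)
  (hf : forall i, C2 (f i))
  (hmono : strongly_monotone (pseudo_gradient f))
  (hundirected : undirected a)
  (hconnected : connected_graph a)
  (hg : smooth_unmodeled g)
  (hd : smooth_disturbance t0 d) :
  forall v1 : R, 0 < v1 ->
  exists thstar : R, 0 < thstar /\ forall theta : R, thstar < theta ->
  exists ksr : R, 0 < ksr /\
    forall ks : 'I_N -> R, (forall i, ksr < ks i) ->
  exists cr : R, 0 < cr /\
    forall c : 'I_N -> R, (forall i, cr < c i) ->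
  exists betar : R, 0 < betar /\
    forall beta : 'I_N -> R, (forall i, betar < beta i) ->
  forall (T : \bar R) (x : R -> 'rV[R]_N) (y : R -> 'M[R]_N)
    (xh zh : R -> 'rV[R]_N),
    (t0%:E < T)%E ->
    closed_loop_solution t0 f g d a (fun i j => theta * thbar i j) ks c beta
      x y xh zh T ->
    enorm (error g d ks x y xh zh xs t0) <= v1 ->
    (* no finite escape time *)
    (exists B : R, forall t, t0 <= t -> (t%:E < T)%E ->
       enorm (error g d ks x y xh zh xs t) <= B) /\
    (T = +oo%E ->
       enorm (error g d ks x y xh zh xs t) @[t --> +oo] --> 0).
Proof.
move=> v1 v10.
have n0 : 0 < N%:R :> R by rewrite ltr0n; exact: leq_trans hN.
have n0' := ltW n0.
have [m [m0 mono]] := strongly_monotoneP hmono.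
have [lam [lam0 lamP]] := pinned_coercive hgraph hundirected hconnected hN.
have [a0 _] := hgraph.
have gC i : C2 (g i) by have [] := hg i.
have /choice[d' /choice[d'' hdd]] := hd.
have /choice[Bi hBi] : forall i, exists b, forall t, t0 <= t -> `|d' i t| <= b /\ `|d'' i t| <= b.
  by move=> i; have [_ _ _ [b hb]] := hdd i; exists b.
pose P : R := 1 + \sum_i \sum_j (thbar i j)^-1.
have P1 : 1 <= P.
  by rewrite lerDl; apply: sumr_ge0 => i _; apply: sumr_ge0 => j _; rewrite invr_ge0 ltW.
have thbP i j : (thbar i j)^-1 <= P.
  have h : (thbar i j)^-1 <= \sum_i \sum_j (thbar i j)^-1.
    by apply: (le_sum2 (F := fun i j => (thbar i j)^-1)) => k l; rewrite invr_ge0 ltW.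
  by rewrite (le_trans h)// /P lerDr.
pose Tb : R := 1 + \sum_i \sum_j thbar i j.
have thbT i j : thbar i j <= Tb.
  have h : thbar i j <= \sum_i \sum_j thbar i j.
    by apply: (le_sum2 (F := thbar)) => k l; exact: ltW.
  by rewrite (le_trans h)// /Tb lerDr.
have Tb1 : 1 <= Tb.
  by rewrite lerDl; apply: sumr_ge0 => i _; apply: sumr_ge0 => j _; rewrite ltW.
have Tb0 : 0 < Tb by exact: lt_le_trans Tb1.
pose pp : R := Tb^-1.
have pp0 : 0 < pp by rewrite invr_gt0.
have pp1 : pp <= 1 by rewrite invf_le1.
have thbp i j : pp <= (thbar i j)^-1 by rewrite lef_pV2 ?posrE.
pose abar : R := \sum_i \sum_j a i j.
have aP i j : 0 <= a i j <= abar by rewrite a0 (le_sum2 i j).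
have abar0 : 0 <= abar by apply: sumr_ge0 => i _; apply: sumr_ge0.
pose n : R := N%:R.
have P0 : 0 <= P by exact: le_trans P1.
have nn : 0 <= n by [].
have n1' : 0 <= n + 1 by rewrite addr_ge0.
have n1 : 1 <= n by rewrite ler1n; exact: leq_trans hN.
have [r [r2 hA]] := @radius_exists R N P pp v1 P1 pp0 n1 v10.
have r0 : 0 < r by apply: lt_le_trans r2; rewrite mulr_gt0.
pose rho : R := \sum_k `|xs 0 k| + 2 * r.
have rhoP k : `|xs 0 k| + 2 * r <= rho.
  by rewrite lerD2r; apply: (ler_term (F := fun k => `|xs 0 k|)).
(* All derivatives that must be bounded on the box form one finite family, so that a single [B]
   serves everywhere. *)
pose dfg (u : 'I_N * 'I_N + ('I_N * 'I_N + 'I_N * 'I_N * 'I_N)) :=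
  match u with
  | inl (i, k) => partial k (partial i (f i))
  | inr (inl (i, j)) => partial j (g i)
  | inr (inr (i, j, k)) => partial k (partial j (g i))
  end.
have [B [B0 hB]] : exists B, 0 <= B /\
    forall u (z : 'rV[R]_N), (forall k, `|z 0 k| <= rho) -> `|dfg u z| <= B.
  apply: box_bound => -[[i k]|[[i j]|[[i j] k]]].
  - by have [_ /(_ i k)[]] := hf i.
  - by have [/(_ j)[]] := gC i.
  - by have [_ /(_ j k)[]] := gC i.
pose Bd : R := \sum_i `|Bi i|.
have BiB i : Bi i <= Bd.
  by apply: le_trans (ler_norm _) _; apply: (ler_term (F := fun i => `|Bi i|)).
have dB1 i t (ht : t0 <= t) : `|d' i t| <= Bd by exact: le_trans (hBi i t ht).1 (BiB i).
have dB2 i t (ht : t0 <= t) : `|d'' i t| <= Bd by exact: le_trans (hBi i t ht).2 (BiB i).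
have stat i : partial i (f i) xs = 0 by apply: nash_stationary hxs; exact: (hf i).1.
pose Q : R := B ^+ 2 * n / m + P * B * n + P ^+ 2 * B ^+ 2 * n ^+ 3 / m + m / 2.
have Q0 : 0 <= Q.
  by rewrite /Q !addr_ge0// ?divr_ge0 ?mulr_ge0 ?exprn_ge0 ?(ltW m0).
exists (Q / lam + 1); split; first by rewrite ltr_wpDl// divr_ge0// ltW.
move=> theta htheta.
have theta0 : 0 < theta by apply: le_lt_trans htheta; rewrite addr_ge0// divr_ge0// ltW.
have thetaP : Q <= theta * lam.
  by rewrite -ler_pdivrMr// ltW// (lt_trans _ htheta)// ltrDl.
exists 1; split => // ks hks.
have ks1 i : 1 <= ks i by exact: ltW.
have ks0 i : 0 <= ks i by exact: le_trans (ks1 i).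
have sks : 0 <= \sum_i ks i by apply: sumr_ge0.
have u1 : 0 <= theta * abar * n by rewrite !mulr_ge0// ltW.
have u2 : 0 <= 2 * n * (B + 1) by rewrite !mulr_ge0// addr_ge0.
exists (1 + \sum_i ks i + theta * abar * n + 2 * n * (B + 1)); split.
  by rewrite ltr_pwDl ?addr_ge0// -!addrA ltr_pwDl// !addr_ge0.
move=> c hc.
have cP i : [/\ \sum_i ks i <= c i, theta * abar * n <= c i & 2 * n * (B + 1) <= c i].
  exact: lt_add_terms (hc i).
have cks i : ks i <= c i by have [h _ _] := cP i; exact: le_trans (ler_term i ks0) h.
have cth i : theta * abar * n <= c i by have [] := cP i.
have cB i : 2 * n * (B + 1) <= c i by have [] := cP i.
pose kc : R := \sum_i (ks i + c i).
have kcP i : ks i + c i <= kc.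
  apply: (ler_term (F := fun i => ks i + c i)) => k.
  by rewrite addr_ge0// (le_trans (ks0 k)).
pose M := @bmin R N theta Tb abar B r Bd kc.
have hbv : 0 <= (1 + B * n) ^+ 2 * v1 by rewrite mulr_ge0 ?sqr_ge0// ltW.
(* The absolute value secures a positive threshold; the last summand controls the initial energy. *)
exists (1 + `|M| + (1 + B * n) ^+ 2 * v1); split; first by rewrite -addrA ltr_pwDl ?addr_ge0.
move=> beta hbeta.
have betaP i : [/\ `|M| <= beta i, (1 + B * n) ^+ 2 * v1 <= beta i & (0 : R) <= beta i].
  by apply: lt_add_terms => //; rewrite addr0.
have bP i : M <= beta i by have [h _ _] := betaP i; exact: le_trans (ler_norm M) h.
have hb i : (1 + B * n) ^+ 2 * v1 <= beta i by have [] := betaP i.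
move=> T x y xh zh t0T sol herr.
have dd i t (ht : t0 <= t) : has_deriv_from t0 (d i) t (d' i t) by have [h _ _ _] := hdd i; exact: h.
have dd' i t (ht : t0 <= t) : has_deriv_from t0 (d' i) t (d'' i t) by have [_ h _ _] := hdd i; exact: h.
have mono' (u v : 'rV[R]_N) : m * \sum_i (u 0 i - v 0 i) ^+ 2 <=
    \sum_i (u 0 i - v 0 i) * (partial i (f i) u - partial i (f i) v).
  by have := mono u v; under [X in _ <= X]eq_bigr do rewrite !mxE.
exact: (@closed_loop_stable R N t0 f g d d' d'' a theta thbar ks c beta x y xh zh xs T
  m P pp Tb abar lam B rho r Bd kc sol hf gC dd dd' m0 mono' stat B0 r0 rhoP
  (fun i k => hB (inl (i, k))) (fun i j => hB (inr (inl (i, j))))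
  (fun i j k => hB (inr (inr (i, j, k)))) dB1 dB2 hthbar thbP thbp thbT P1 pp0 pp1 aP lamP theta0 thetaP
  ks1 cks cth cB kcP bP v1 v10 r2 n0 hA hb t0T herr).
Qed.
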